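(* Assume that there is a stationary set $S\subseteq\omega_2$ such that (a) $\mathrm{cf}(\alpha)=\omega$ for every $\alpha\in S$, and (b) $S\cap\beta$ is not stationary in $\beta$ for every $\beta<\omega_2$ with $\mathrm{cf}(\beta)=\omega_1$. Then there exists a Banach space $\mathfrak X$ of density $\omega_2$ such that (i) $\mathfrak X$ is not weakly compactly generated; (ii) every subspace $\mathfrak Y\subseteq\mathfrak X$ of density $\le\omega_1$ is weakly compactly generated.
   Context: For a limit ordinal $\gamma$, a set $F\subseteq\gamma$ is closed if it is closed in the interval (order) topology on $\gamma$, and unbounded if for every $\beta<\gamma$ there is $\alpha\in F$ with $\beta<\alpha$; $S\subseteq\gamma$ is stationary in $\gamma$ if $S\cap F\ne\emptyset$ for every closed unbounded $F\subseteq\gamma$. A Banach space $\mathfrak X$ is weakly compactly generated (WCG) if there is a weakly compact set $C\subseteq\mathfrak X$ such that $\mathfrak X=\overline{\mathrm{span}}(C)$. The density of a Banach space is the minimal cardinality of a norm-dense subset. A subspace of a Banach space means a closed linear subspace. *)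

(* Defs.v *)
From HB Require Import structures.
From mathcomp Require Import all_boot all_order all_algebra.
From mathcomp Require Import all_classical all_reals all_analysis.
From mathcomp Require wochoice.

Set Implicit Arguments.
Unset Strict Implicit.
Unset Printing Implicit Defensive.

Import Order.TTheory GRing.Theory Num.Theory.
Import numFieldNormedType.Exports.

Local Open Scope classical_set_scope.
Local Open Scope ring_scope.
Local Open Scope card_scope.

(** Ordinals are represented by well-ordered types [W : orderType d], and an
    ordinal [a < W] by the type of its predecessors [below a]. *)

Section ordinals.
Context {d : Order.disp_t}.
Implicit Types W : orderType d.

Definition well_ordered W := wochoice.well_order (<=%O : rel W).

Definition below W (a : W) : orderType d := sub_type {x : W | (x < a)%O}.

(** For infinite [K] this says that [W] is order isomorphic to the initial
    ordinal of the successor cardinal of [|K|]: it is the least ordinal that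
    does not inject into [K]. *)
Definition is_successor_cardinal (K : Type) W :=
  [/\ well_ordered W, ~ ([set: W] #<= [set: K]) &
      forall a : W, [set: below a] #<= [set: K]].

Definition cofinal W (A : set W) := forall x, exists2 y, A y & (x <= y)%O.

(** The cofinality of [W] is the cardinal [|K|].  The inequality in [cofinal]
    is large, so that 0 has cofinality 0 and successors have cofinality 1. *)
Definition has_cofinality W (K : Type) :=
  (exists2 A : set W, cofinal A & A #= [set: K]) /\
  (forall A : set W, cofinal A -> [set: K] #<= A).

(** [S] intersected with the ordinal [b]. *)
Definition trace W (S : set W) (b : W) : set (below b) :=
  [set x | S (\val (x : {x : W | (x < b)%O}))].

Definition unbounded W (A : set W) := forall b, exists2 a, A a & (b < a)%O.

Definition stationary W (S : set W) :=
  forall F : set W, closed (F : set (order_topology W)) -> unbounded F ->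
    S `&` F !=set0.

End ordinals.
Arguments trace {d W} S b.

Definition is_omega1 d (W : orderType d) := is_successor_cardinal nat W.

Section density.
Context {X : topologicalType}.

Definition has_density (U : Type) (K : set U) :=
  (exists2 D : set X, dense D & D #= K) /\
  (forall D : set X, dense D -> K #<= D).

Definition density_le (K : Type) :=
  exists2 D : set X, has_density D & D #<= [set: K].

End density.
Arguments has_density X {U} K.
Arguments density_le X K : clear implicits.

Section weak_topology.
Context {R : realType} (X : normedModType R).

Definition dual := {f : {scalar X} | continuous (f : X -> R)}.

Definition weak_topology : topologicalType :=
  sup_topology (fun f : dual => Topological.on (initial_topology (sval f : X -> R))).

Definition linear_span (C : set X) : set X :=
  [set x | exists n (a : 'I_n -> R) (c : 'I_n -> X),
    (forall i, C (c i)) /\ x = \sum_(i < n) a i *: c i].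

Definition weakly_compact (C : set X) := compact (C : set weak_topology).

Definition weakly_compactly_generated :=
  exists2 C : set X, weakly_compact C & closure (linear_span C) = [set: X].

End weak_topology.

Record closed_subspace (R : realType) (X : completeNormedModType R) :=
  ClosedSubspace {
    subspace_pred : {pred X} ;
    subspace_submod : submod_closed subspace_pred ;
    subspace_closed : closed [set` subspace_pred] }.

Arguments subspace_submod {R X} Y : rename.
Arguments subspace_closed {R X} Y : rename.

Section closed_subspace_banach.
Context {R : realType} {X : completeNormedModType R} (Y : closed_subspace X).

Definition subspace_sort := {x : X | x \in subspace_pred Y}.

HB.instance Definition _ := SubChoice.on subspace_sort.
HB.instance Definition _ := GRing.SubChoice_isSubLmodule.Build R X
  (subspace_pred Y) subspace_sort (subspace_submod Y).

Let norm (y : subspace_sort) : R := `|val y|.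
Let ler_normD y z : norm (y + z) <= norm y + norm z.
Proof. by rewrite /norm raddfD ler_normD. Qed.
Let normrZ l y : norm (l *: y) = `|l| * norm y.
Proof. by rewrite /norm linearZ normrZ. Qed.
Let normr0_eq0 y : norm y = 0 -> y = 0.
Proof. by move=> /normr0_eq0 y0; apply/val_inj; rewrite raddf0. Qed.

HB.instance Definition _ :=
  Lmodule_isNormed.Build R subspace_sort ler_normD normrZ normr0_eq0.

Lemma subspace_complete (F : set_system subspace_sort) :
  ProperFilter F -> cauchy F -> cvg F.
Proof.
move=> FF Fc.
have valB (y z : subspace_sort) : `|val y - val z| = `|y - z|.
  by rewrite -raddfB.
have : cauchy (val @ F : set_system X).
  apply/cauchy_ballP => e e0.
  move/cauchy_ballP : Fc => /(_ _ e0).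
  case=> -[A B] /= [FA FB] AB.
  exists (val @` A, val @` B) => /=.
    split; [apply: filterS FA|apply: filterS FB] => y yA /=; by exists y.
  move=> -[_ _] /= [[y Ay <-] [z Bz <-]] /=.
  have := AB (y, z) (conj Ay Bz).
  by rewrite -!ball_normE /ball_ /= valB.
move=> /cauchy_cvg /cvg_ex[x Fx].
have xY : x \in subspace_pred Y.
  have valY : \forall y \near F, [set` subspace_pred Y] (val (y : subspace_sort)).
    by apply: nearW => y; exact: (valP y).
  exact: (closed_cvg _ (subspace_closed Y) valY _ Fx).
apply/cvg_ex; exists (exist _ x xY).
apply/cvgrPdist_lt => e e0.
move/cvgrPdist_lt : Fx => /(_ _ e0).
by apply: filterS => y; rewrite -valB.
Qed.

HB.instance Definition _ := Uniform_isComplete.Build subspace_sort subspace_complete.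

Definition subspace_banach : completeNormedModType R := subspace_sort.

End closed_subspace_banach.

(* Main.v *)
Require Import Defs.
From HB Require Import structures.
From mathcomp Require Import all_boot all_order all_algebra.
From mathcomp Require Import all_classical all_reals all_analysis.
From mathcomp Require Import lra.

(** The space is built from a ladder system on [S].  Every [a] in [S] has
    cofinality omega, so it carries a ladder [c a]: a subset of [a] of order
    type omega, cofinal in [a], which can be taken to consist of successor
    ordinals and hence to be disjoint from [S].  Put [c a = set0] for [a]
    outside [S].  The space [X] is the closed linear span, in the bounded
    functions on omega_2 with the supremum norm, of the indicators of the sets
    consisting of [a] and of the points of [c a], one for each ordinal [a].
    Every [f] in [X] converges to [f a] along the ladder [c a], for [a] in [S]
    ([in_span_ladder_cvg]).

    [X] is not weakly compactly generated ([ladder_space_not_wcg]).  Let [C] be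
    weakly compact with dense span.  The ordinals [a] such that every finite
    system of approximate values prescribed at points below [a], if realised in
    [C], is realised by an element of [C] in the closed span of the generators
    below [a] contain a closed unbounded set, which meets [S] in some [a].  Some [x] in
    [C] does not vanish at [a].  Elements [x_n] of [C] in the closed span
    of the generators below [a], and thus vanishing at [a], can be chosen whose values
    tend to those of [x] at infinitely many points of the ladder of [a].  A weak
    cluster point of [x_n] is zero at [a] but agrees with [x] at these points,
    so that its limit along the ladder is [x a], which is not zero.

    A subspace [Y] of density at most omega_1 lies in the closed span of the
    generators below some [b] ([density_le_in_span_below]).  By induction on
    [b], finite initial parts of the ladders of the elements of [S] up to [b]
    can be removed so that the remainders are pairwise disjoint
    ([nonreflecting_disjointifiable]): when [b] has cofinality omega_1, a closed
    unbounded subset of [b] disjoint from [S] reduces the claim to its gaps.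
    The remainders, with their tops, and the other points below [b] form
    countable blocks, at most omega_1 of them, and the elements of [Y] are
    [c_0] over the blocks and lie in a separable space on each block.

    Such a [Y] is weakly compactly generated ([c0_blocks_wcg]).  For a set [A]
    of blocks closed under a suitable witness function, the restriction of each
    [z] in [Y] to the blocks in [A] is again in [Y]: it is the limit of averages
    of witnesses in [Y] which are supported on [A], are close to [z] on larger
    and larger finite sets of blocks, and are small off the next such set
    ([restriction_approx]).  Closing off along omega_1 thus groups the blocks
    into countable groups such that [Y] is the [c_0]-sum of its separable parts
    on the groups; dense sequences in the parts, scaled to tend to zero,
    together with zero form a weakly compact generating set. *)

Set Implicit Arguments.
Unset Strict Implicit.
Unset Printing Implicit Defensive.

Import Order.TTheory GRing.Theory Num.Theory.
Import numFieldNormedType.Exports.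

Local Open Scope classical_set_scope.
Local Open Scope ring_scope.
Local Open Scope card_scope.

(** * Cardinal arithmetic *)

(** Comparison of cardinals through a relation, so that no default value is
    needed in the target. *)
Lemma card_le_relP T U (A : set T) (B : set U) :
  A #<= B <-> exists r : T -> U -> Prop,
    (forall x, A x -> exists2 y, B y & r x y) /\
    (forall x x' y, A x -> A x' -> r x y -> r x' y -> x = x').
Proof.
split=> [/card_leP[f]|[r [rex rinj]]].
  exists (fun x y => exists2 u : A, val u = x & val (f u) = y); split.
    move=> x Ax; exists (val (f (exist _ x (mem_set Ax)))).
      by apply/set_mem/(valP (f _)).
    by exists (exist _ x (mem_set Ax)).
  move=> x x' y _ _ [u <- <-] [v <- fuv].
  suff -> : u = v by [].
  by apply: (@inj _ _ _ f); rewrite ?in_setT//; exact/val_inj/esym.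
have H (u : A) : exists v : B, r (val u) (val v).
  have /rex[y By ruy] : A (val u) by apply/set_mem/(valP u).
  by exists (exist _ y (mem_set By)).
have [f fP] := choice H.
have finj : set_inj [set: A] f.
  move=> u v _ _ fuv; apply/val_inj; apply: rinj (fP u) _.
  - exact/set_mem/(valP u).
  - exact/set_mem/(valP v).
  - by rewrite fuv; exact: fP.
have /squash F : {injfun [set: A] >-> [set: B]}.
  have /injPex/unsquash g : exists f : A -> B, set_inj [set: A] f by exists f.
  exact: ('totalfun_setT g).
by apply/asboolP.
Qed.

Lemma card_leTTP T U :
  [set: T] #<= [set: U] <-> exists f : T -> U, injective f.
Proof.
split=> [/card_le_relP[r [rex rinj]]|[f finj]].
  have /choice[f fP] : forall x, exists y, r x y.
    by move=> x; have [|y _ rxy] := rex x; [|exists y].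
  exists f => x y fxy; apply: rinj (fP x) _ => //.
  by rewrite fxy.
apply/card_le_relP; exists (fun x y => f x = y); split=> [x _|x y _ _ _ <- /finj//].
by exists (f x).
Qed.

Lemma card_le_inj T U (A : set T) (B : set U) (f : T -> U) :
  {in A &, injective f} -> (forall x, A x -> B (f x)) -> A #<= B.
Proof.
move=> finj fB; apply/card_le_relP; exists (fun x y => f x = y).
split=> [x Ax|x y _ Ax Ay <- fxy]; first by exists (f x) => //; exact: fB.
by apply: finj; rewrite ?inE.
Qed.

Lemma card_le_ex_inj T U (A : set T) (B : set U) : A #<= B -> U ->
  exists2 f : T -> U, {in A &, injective f} & forall x, A x -> B (f x).
Proof.
move=> /card_le_relP[r [rex rinj]] u0.
have /choice[f fP] : forall x, exists y, A x -> B y /\ r x y.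
  move=> x; have [/rex[y By rxy]|nAx] := pselect (A x); first by exists y.
  by exists u0.
exists f => [x y|x /fP[]//]; rewrite !inE => Ax Ay fxy.
have [_ rx] := fP _ Ax; have [_ ry] := fP _ Ay.
by apply: rinj rx _ => //; rewrite fxy.
Qed.

(** [K] is infinite and absorbs products: it contains copies of [nat] and of
    [K * K]. *)
Definition absorbing K := exists (i : nat -> K) (j : K * K -> K),
  injective i /\ injective j.

Lemma absorbing_nat : absorbing nat.
Proof.
have /card_leTTP[j jinj] : [set: nat * nat] #<= [set: nat].
  by have := card_nat2; rewrite card_eq_le => /andP[].
by exists id, j; split.
Qed.

Section absorbing.
Context (K : Type) (Kabs : absorbing K).

Lemma absorbing_card_nat : [set: nat] #<= [set: K].
Proof. by have [i [_ [iinj _]]] := Kabs; apply/card_leTTP; exists i. Qed.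

Lemma countable_card_le T (A : set T) : countable A -> A #<= [set: K].
Proof. by move=> /card_le_trans; apply; exact: absorbing_card_nat. Qed.

Lemma card_bigcup_le I T (D : set I) (F : I -> set T) :
  D #<= [set: K] -> (forall i, D i -> F i #<= [set: K]) ->
  \bigcup_(i in D) F i #<= [set: K].
Proof.
have [i0 [j [_ jinj]]] := Kabs => DK FK; have k0 : K := i0 0%N.
have [d dinj _] := card_le_ex_inj DK k0.
have /choice[f fP] : forall i, exists f : T -> K, D i -> {in F i &, injective f}.
  move=> i; have [/FK Di|nD] := pselect (D i); last by exists (fun=> k0).
  by have [f finj _] := card_le_ex_inj Di k0; exists f.
apply/card_le_relP.
exists (fun x y => exists2 i, D i /\ F i x & y = j (d i, f i x)); split.
  by move=> x [i Di Fix]; exists (j (d i, f i x)) => //; exists i.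
move=> x x' y _ _ [i [Di Fx] ->] [i' [Di' Fx'] /jinj[]].
by move=> /dinj; rewrite !inE => /(_ Di Di') ii'; subst i' => /fP; apply; rewrite ?inE.
Qed.

Lemma card_setU_le T (A B : set T) :
  A #<= [set: K] -> B #<= [set: K] -> A `|` B #<= [set: K].
Proof.
move=> AK BK; have -> : A `|` B = \bigcup_(b in [set: bool]) (if b then A else B).
  by rewrite eqEsubset; split=> [x [Ax|Bx]|x [[] _]]; [exists true|exists false|left|right].
by apply: card_bigcup_le => [|[]//]; exact/countable_card_le/countableP.
Qed.

Lemma card_setX_le T U (A : set T) (B : set U) :
  A #<= [set: K] -> B #<= [set: K] -> A `*` B #<= [set: K].
Proof.
have [i0 [j [_ jinj]]] := Kabs => AK BK; have k0 : K := i0 0%N.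
have [f finj _] := card_le_ex_inj AK k0.
have [g ginj _] := card_le_ex_inj BK k0.
apply: (card_le_inj (f := fun p => j (f p.1, g p.2))) => // -[a b] [a' b'].
rewrite !inE => -[/= Aa Bb] [/= Aa' Bb'] /jinj[].
by move=> /finj -> //; rewrite ?inE// => /ginj -> //; rewrite ?inE.
Qed.

Lemma card_seq_le (T : eqType) (A : set T) : A #<= [set: K] ->
  [set s : seq T | forall x, x \in s -> A x] #<= [set: K].
Proof.
have [i [j [iinj jinj]]] := Kabs => AK; have k0 : K := i 0%N.
have [f finj _] := card_le_ex_inj AK k0.
pose enc (s : seq T) := foldr (fun x y => j (f x, y)) k0 s.
apply: (card_le_inj (f := fun s => j (i (size s), enc s))) => // s s'.
rewrite !inE => + + /jinj[/iinj].
elim: s s' => [|x s IH] [|x' s']//= As As' [sz] /jinj[].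
have Ax : A x by apply: As; rewrite mem_head.
have Ax' : A x' by apply: As'; rewrite mem_head.
move=> /finj; rewrite !inE => /(_ Ax Ax') ->.
move=> /(IH _ _ _ sz) -> // y ys; [apply: As|apply: As'];
  by rewrite in_cons ys orbT.
Qed.

End absorbing.

(** * Well-ordered types and successor cardinals *)

Section well_orders.
Context {d : Order.disp_t} (W : orderType d) (wo : well_ordered W).
Implicit Types (a b x y : W) (A : set W).

Lemma wo_least A : A !=set0 -> exists2 m, A m & forall x, A x -> (m <= x)%O.
Proof.
move=> [a Aa]; have [|m [[mA mmin] _]] := wo (A := [pred x | `[<A x>]]).
  by exists a; apply/asboolP.
exists m; first exact/asboolP.
by move=> x Ax; apply: mmin; apply/asboolP.
Qed.

Lemma wo_wf : well_founded (fun x y => (x < y)%O).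
Proof.
move=> x; apply: contrapT => nx.
have [|m nm mmin] := @wo_least [set x | ~ Acc (fun x y => (x < y)%O) x].
  by exists x.
apply: nm; constructor => y ym; apply: contrapT => /mmin.
by rewrite leNgt ym.
Qed.

Lemma wo_ind (P : W -> Prop) :
  (forall x, (forall y, (y < x)%O -> P y) -> P x) -> forall x, P x.
Proof. exact: (well_founded_ind wo_wf). Qed.

End well_orders.

(** Transfinite recursion: each [t] is sent to a point of [B] that is not the
    image of a predecessor of [t]; there is one since the predecessors are too
    few to cover [B]. *)
Lemma embed_of_small_segments (T U : Type) (lt : T -> T -> Prop) (B : set U) :
  well_founded lt -> (forall x y, x = y \/ lt x y \/ lt y x) ->
  (forall t, ~ (B #<= [set s | lt s t])) -> [set: T] #<= B.
Proof.
move=> wf tot Bbig.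
have H t (rec : forall s, lt s t -> U) :
    exists b, B b /\ forall s (st : lt s t), rec s st <> b.
  apply: contrapT => nex; apply: (Bbig t); apply/card_le_relP.
  exists (fun b s => exists st : lt s t, rec s st = b).
  split=> [b Bb|b b' s _ _ [st <-] [st' <-]]; last by rewrite (Prop_irrelevance st st').
  apply: contrapT => nb; apply: nex; exists b; split=> // s st rb.
  by apply: nb; exists s => //; exists st.
pose F t rec := projT1 (cid (H t rec)).
pose f := Fix wf (fun=> U) F.
have fE t : f t = F t (fun s _ => f s).
  apply: Fix_eq => {}t r r' rr'; congr F.
  by apply/functional_extensionality_dep => s; apply/funext => st.
have fP t : B (f t) /\ forall s, lt s t -> f s <> f t.
  rewrite fE /F; case: (cid _) => b /= [Bb bP]; split; [exact: Bb|] => s st.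
  exact: (bP s st).
apply: (card_le_inj (f := f)) => [x y _ _ fxy|x _]; last by have [] := fP x.
have [//|[xy|yx]] := tot x y.
  by have [_ /(_ _ xy)] := fP y; rewrite fxy.
by have [_ /(_ _ yx)] := fP x; rewrite fxy.
Qed.

Section order_topology.
Context {d : Order.disp_t} {W : orderType d}.
Implicit Types (a b : W) (F : set W).

Lemma nbhs_order_lt a b : (a < b)%O ->
  nbhs (a : order_topology W) [set x | (x < b)%O].
Proof.
move=> ab; have := @lray_open _ (order_topology W) b; rewrite openE.
move=> /(_ a); rewrite /interior /= in_itv /= => /(_ ab); apply: filterS => x.
by rewrite /= in_itv.
Qed.

Lemma nbhs_order_gt a b : (b < a)%O ->
  nbhs (a : order_topology W) [set x | (b < x)%O].
Proof.
move=> ba; have := @rray_open _ (order_topology W) b; rewrite openE.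
move=> /(_ a); rewrite /interior /= in_itv /= ba => /(_ isT); apply: filterS => x.
by rewrite /= in_itv andbT.
Qed.

(** Below a point outside of it, a closed set is bounded away from the point. *)
Lemma order_closed_gap F a a0 : closed (F : set (order_topology W)) ->
  ~ F a -> (a0 < a)%O ->
  exists2 b, (b < a)%O & forall x, F x -> (x <= a)%O -> (x <= b)%O.
Proof.
move=> Fcl nFa a0a; have : nbhs (a : order_topology W) (~` F).
  by apply: open_nbhs_nbhs; split=> //; exact/closed_openC.
rewrite itv_nbhsE => -[[p q] [pq aI]] IF; move: aI.
rewrite /= itv_boundlr => /andP[pa aq].
have key b : (b < a)%O -> (forall x : W, (b < x)%O -> (p <= BLeft x)%O) ->
    exists2 b, (b < a)%O & forall x, F x -> (x <= a)%O -> (x <= b)%O.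
  move=> ba bI; exists b => // x Fx xa; rewrite leNgt; apply/negP => bx.
  apply: (IF x) => //=; rewrite itv_boundlr bI//=.
  by apply: le_trans aq; rewrite bnd_simp.
case: p pq pa key {IF} => [c y /itv_open_ends_lside -> ya key|c].
  by apply: (key y) => // x yx; rewrite bnd_simp.
by move=> /itv_open_ends_linfty -> _ key; apply: (key a0).
Qed.

End order_topology.

Section successor_cardinal.
Context (K : Type) (Kabs : absorbing K).
Context {d : Order.disp_t} (W : orderType d) (hW : is_successor_cardinal K W).
Implicit Types (a b x y : W) (A : set W).

Let wo : well_ordered W. Proof. by case: hW. Qed.

Lemma succ_card_ninj : ~ ([set: W] #<= [set: K]).
Proof. by case: hW. Qed.

Lemma card_below_le a : [set x | (x < a)%O] #<= [set: K].
Proof.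
case: hW => _ _ /(_ a); apply: card_le_trans.
apply/card_le_relP; exists (fun x (u : below a) => \val (u : {x | (x < a)%O}) = x).
split=> [x xa|x x' u _ _ <- <-//].
by exists (exist _ x xa : {x | (x < a)%O}).
Qed.

Lemma card_beloweq_le a : [set x | (x <= a)%O] #<= [set: K].
Proof.
have -> : [set x | (x <= a)%O] = [set x | (x < a)%O] `|` [set a].
  rewrite eqEsubset; split=> [x /=|x [/ltW//|->//=]].
  by rewrite le_eqVlt => /orP[/eqP->|]; [right|left].
by apply: card_setU_le (card_below_le a) _ => //; exact/countable_card_le/countable1.
Qed.

(** Regularity of successor cardinals. *)
Lemma succ_card_bounded T (D : set T) (f : T -> W) : D #<= [set: K] ->
  exists b, forall t, D t -> (f t < b)%O.
Proof.
move=> DK; apply: contrapT => nb; apply: succ_card_ninj.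
have -> : [set: W] = \bigcup_(t in D) [set x | (x <= f t)%O].
  rewrite eqEsubset; split=> // b _; apply: contrapT => nbD.
  apply: nb; exists b => t Dt; rewrite ltNge; apply/negP => bt.
  by apply: nbD; exists t.
by apply: card_bigcup_le => // t _; exact: card_beloweq_le.
Qed.

Lemma succ_card_nomax a : exists b, (a < b)%O.
Proof.
have [|b bP] := @succ_card_bounded unit setT (fun=> a).
  exact/countable_card_le/countableP.
by exists b; apply: (bP tt).
Qed.

(** Pairs are ordered by their maximum, then lexicographically: an initial
    segment is contained in a square of an initial segment of [W]. *)
Lemma succ_card_absorbing : absorbing W.
Proof.
have Winf : [set: nat] #<= [set: W].
  apply/infiniteP => /finite_set_countable.
  by move=> /(countable_card_le Kabs); exact: succ_card_ninj.
have [i iinj] : exists i : nat -> W, injective i by exact/card_leTTP.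
suff /card_leTTP[j jinj] : [set: W * W] #<= [set: W] by exists i, j.
pose m (p : W * W) := Order.max p.1 p.2.
pose lt p q := (m p < m q)%O \/
  (m p = m q /\ ((p.1 < q.1)%O \/ (p.1 = q.1 /\ (p.2 < q.2)%O))).
apply: (@embed_of_small_segments _ _ lt).
- suff H x : forall p, m p = x -> Acc lt p by move=> p; exact: (H (m p)).
  elim/(wo_ind wo): x => x IHx.
  suff H y : forall p, m p = x -> p.1 = y -> Acc lt p by move=> p px; exact: (H p.1).
  elim/(wo_ind wo): y => y IHy.
  suff H z : forall p, m p = x -> p.1 = y -> p.2 = z -> Acc lt p.
    by move=> p px py; exact: (H p.2).
  elim/(wo_ind wo): z => z IHz p px py pz.
  constructor => q [|[mq [|[q1]]]].
  + by rewrite px => /IHx/(_ q erefl).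
  + by rewrite py => /IHy/(_ q); rewrite mq => /(_ px erefl).
  + by rewrite pz => /IHz/(_ q); rewrite mq q1 => /(_ px py erefl).
- move=> p q; case: (ltgtP (m p) (m q)) => mpq; [by right; left; left|by right; right; left|].
  case: (ltgtP p.1 q.1) => pq1.
  + by right; left; right; split=> //; left.
  + by right; right; right; split=> //; left.
  case: (ltgtP p.2 q.2) => pq2.
  + by right; left; right; split=> //; right.
  + by right; right; right; split=> //; right.
  by left; case: p q pq1 pq2 {mpq} => [? ?] [? ?] /= -> ->.
- move=> q; have sub : [set p | lt p q] `<=`
      [set x | (x <= m q)%O] `*` [set x | (x <= m q)%O].
    move=> p /= ltpq; have : (m p <= m q)%O by case: ltpq => [/ltW//|[->]].
    by rewrite /m ge_max => /andP[].
  move=> /card_le_trans/(_ (subset_card_le sub)).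
  move=> /card_le_trans/(_ (card_setX_le Kabs (card_beloweq_le _) (card_beloweq_le _))).
  exact: succ_card_ninj.
Qed.

(** Any set that is too large for [K] contains a copy of [W]. *)
Lemma succ_card_min T (A : set T) : ~ (A #<= [set: K]) -> [set: W] #<= A.
Proof.
move=> nA; apply: (embed_of_small_segments (wo_wf wo)).
  by move=> x y; case: (ltgtP x y); [right; left|right; right|left].
by move=> t /card_le_trans/(_ (card_below_le t)).
Qed.

(** The points that bound the values of [b] on the finite sequences of smaller
    points, each of them labelled by a natural number; [b] has one further
    argument in [nat].  These points form a closed unbounded set. *)
Definition closed_under (b : seq (W * nat) * nat -> W) : set W :=
  [set a | forall s n, (forall p, p \in s -> (p.1 < a)%O) -> (b (s, n) <= a)%O].

Lemma closed_under_unbounded (b : seq (W * nat) * nat -> W) : unbounded (closed_under b).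
Proof.
move=> x0.
have /choice[h hP] : forall x, exists y, (x < y)%O /\
    forall s n, (forall p, p \in s -> (p.1 < x)%O) -> (b (s, n) < y)%O.
  move=> x; pose D := [set s : seq (W * nat) |
    forall p, p \in s -> ([set x' | (x' < x)%O] `*` setT) p] `*` [set: nat].
  have DK : D #<= [set: K].
    apply: card_setX_le => //; last exact/countable_card_le/countableP.
    apply: card_seq_le => //; apply: card_setX_le => //.
      exact: card_below_le.
    exact/countable_card_le/countableP.
  have [y1 y1P] := succ_card_bounded b DK.
  have [y2 y2P] := succ_card_nomax x.
  exists (Order.max y1 y2); rewrite lt_max y2P orbT; split=> // s n sx.
  by rewrite lt_max y1P//; split=> //= p /sx.
(* The least upper bound of the orbit of [x0] under [h] is closed under [b]. *)
pose f n := iter n h x0.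
have fS n : (f n < f n.+1)%O by exact: (hP _).1.
have fmono m n : (m <= n)%N -> (f m <= f n)%O.
  elim: n => [|n IH]; first by rewrite leqn0 => /eqP->.
  by rewrite leq_eqVlt => /predU1P[->//|/IH/le_trans]; apply; exact/ltW.
have [b0 b0P] : exists b0, forall n, setT n -> (f n < b0)%O.
  by apply: succ_card_bounded; exact/countable_card_le/countableP.
have [|a aub amin] := @wo_least _ _ wo [set a | forall n, (f n < a)%O].
  by exists b0 => n; exact: b0P.
have afin x : (x < a)%O -> exists n, (x < f n)%O.
  move=> xa; apply: contrapT => nn; move: xa; apply/negP; rewrite -leNgt; apply: amin => n.
  apply: lt_le_trans (fS n) _; rewrite leNgt; apply/negP => xn; apply: nn.
  by exists n.+1.
exists a; last exact: (aub 0%N).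
move=> s n sa; have [N NP] : exists N, forall p, p \in s -> (p.1 < f N)%O.
  elim: s sa => [|q s IH] sa; first by exists 0%N.
  have [|N NP] := IH; first by move=> p ps; apply: sa; rewrite in_cons ps orbT.
  have [M MP] := afin q.1 (sa q (mem_head _ _)).
  exists (maxn N M) => p; rewrite in_cons => /predU1P[->|/NP pN].
    by apply: lt_le_trans MP _; apply: fmono; exact: leq_maxr.
  by apply: lt_le_trans pN _; apply: fmono; exact: leq_maxl.
apply/ltW/(lt_trans ((hP _).2 _ _ NP)); exact: (aub N.+1).
Qed.

Lemma closed_under_closed (b : seq (W * nat) * nat -> W) :
  closed (closed_under b : set (order_topology W)).
Proof.
rewrite -openC openE => a /existsNP[s /existsNP[n]].
move=> /not_implyP[sa]; move/negP; rewrite -ltNge => ab.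
have [s0|[y [ya yP]]] : s = [::] \/ exists y, (y < a)%O /\
    forall p, p \in s -> (p.1 <= y)%O.
  elim: s sa {ab} => [|q s IH] sa; [by left|right].
  have qa : (q.1 < a)%O by apply: sa; rewrite mem_head.
  have [|->|[y [ya yP]]] := IH; first by move=> p ps; apply: sa; rewrite in_cons ps orbT.
    by exists q.1; split=> // p; rewrite inE => /eqP->.
  exists (Order.max q.1 y); rewrite gt_max ya qa; split=> // p.
  by rewrite in_cons le_max => /predU1P[->|/yP->]; rewrite ?lexx ?orbT.
- rewrite s0 in ab; have xb0 := nbhs_order_lt ab.
  apply: (@filterS _ _ (@nbhs_filter (order_topology W) a) _ _ _ xb0) => x xb /(_ [::] n) H.
  by move: xb; rewrite /= ltNge H.
- have xb0 := @filterI _ _ (@nbhs_filter (order_topology W) a) _ _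
    (nbhs_order_lt ab) (nbhs_order_gt ya).
  apply: (@filterS _ _ (@nbhs_filter (order_topology W) a) _ _ _ xb0) => x.
  move=> [xb yx].
  move=> /(_ s n) H; move: xb; rewrite /= ltNge H// => p ps.
  exact: le_lt_trans (yP _ ps) yx.
Qed.

End successor_cardinal.

(** * Ladders *)

Lemma finite_below_bounded d (W : orderType d) (A : set W) (a a0 : W) :
  (a0 < a)%O -> finite_set A -> (forall x, A x -> (x < a)%O) ->
  exists2 b, (b < a)%O & forall x, A x -> (x <= b)%O.
Proof.
move=> a0a /finite_seqP[s ->]; elim: s => [|y s IH] sa; first by exists a0.
have [|b ba bP] := IH; first by move=> x xs; apply: sa; rewrite /= in_cons; apply/orP; right.
exists (Order.max y b); first by rewrite gt_max ba sa//= mem_head.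
by move=> x /=; rewrite in_cons le_max => /predU1P[->|/bP->]; rewrite ?lexx ?orbT.
Qed.

Lemma countable_cofinal_seq T (A : set T) : countable A -> A !=set0 ->
  exists u : nat -> T, (forall n, A (u n)) /\ forall x, A x -> exists n, u n = x.
Proof.
move=> /card_le_ex_inj/(_ 0%N)[f finj _] [x0 Ax0].
have /choice[u uP] : forall n, exists x, A x /\ ((exists2 y, A y & f y = n) -> f x = n).
  move=> n; have [[y Ay fy]|ny] := pselect (exists2 y, A y & f y = n); first by exists y.
  by exists x0; split.
exists u; split=> [n|x Ax]; first by have [] := uP n.
exists (f x); have [Au fu] := uP (f x).
by apply: finj; rewrite ?inE//; apply: fu; exists x.
Qed.

Section ladder.
Context {d : Order.disp_t} (W : orderType d) (wo : well_ordered W).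
Implicit Types (a b e x y z : W).

(** [x] is a successor ordinal. *)
Definition is_succ x := exists2 y, (y < x)%O & forall z, (z < x)%O -> (z <= y)%O.

(** [a] is a limit ordinal or zero. *)
Definition is_limit a := forall x, (x < a)%O -> exists2 y, (x < y)%O & (y < a)%O.

Lemma limit_not_succ a : is_limit a -> ~ is_succ a.
Proof.
move=> la [y /la[z yz za] /(_ _ za)]; by rewrite leNgt yz.
Qed.

(** A ladder: a subset of [a] of order type omega, cofinal in [a] and
    consisting of successor ordinals.  It is extracted as the set of record
    values of the sequence of the successors of the [u n]. *)
Lemma ladder_exists a (u : nat -> W) : is_limit a ->
  (forall n, (u n < a)%O) -> (forall x, (x < a)%O -> exists n, (x <= u n)%O) ->
  exists c : set W, [/\ forall x, c x -> (x < a)%O, forall x, c x -> is_succ x,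
    forall y, (y < a)%O -> finite_set (c `&` [set x | (x <= y)%O]),
    forall y, (y < a)%O -> exists2 x, c x & (y < x)%O & countable c].
Proof.
move=> la ua ucof.
have /choice[sc scP] : forall x, exists y, (x < a)%O ->
    [/\ (x < y)%O, (y < a)%O & forall z, (x < z)%O -> (y <= z)%O].
  move=> x; have [xa|nxa] := pselect (x < a)%O; last by exists x.
  have [y0 xy0 y0a] := la _ xa.
  have [|y xy ymin] := @wo_least _ _ wo [set y | (x < y)%O]; first by exists y0.
  exists y => _; split=> //; exact: le_lt_trans (ymin _ xy0) y0a.
pose v n := sc (u n).
exists [set x | exists n, x = v n /\ forall m, (m < n)%N -> (v m < v n)%O]; split.
- by move=> _ [n [-> _]]; have [] := scP _ (ua n).
- move=> _ [n [-> _]]; have [uv _ vmin] := scP _ (ua n).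
  by exists (u n) => // z; rewrite !ltNge => /negP zv; rewrite leNgt; apply/negP => /vmin.
- move=> y /ucof[N yN]; apply: (@sub_finite_set _ _ (v @` `I_N)); last first.
    exact/finite_image/finite_II.
  move=> _ [[n [-> nP]] /= ny]; exists n => //=; rewrite ltnNge; apply/negP => Nn.
  have yv : (y < v N)%O by apply: le_lt_trans yN _; have [] := scP _ (ua N).
  have : (v N <= v n)%O.
    by move: Nn; rewrite leq_eqVlt => /predU1P[->//|/nP/ltW].
  by rewrite leNgt (le_lt_trans ny yv).
- move=> y /ucof[N yN].
  have yv : (y < v N)%O by apply: le_lt_trans yN _; have [] := scP _ (ua N).
  have ex : exists n, (y < v n)%O by exists N.
  exists (v (ex_minn ex)); last by case: ex_minnP.
  exists (ex_minn ex); split=> //; case: ex_minnP => n yn nmin m mn.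
  apply: le_lt_trans yn; rewrite leNgt; apply/negP => /nmin.
  by rewrite leqNgt mn.
- apply: (@sub_countable _ _ _ (range v)); last first.
    apply: card_le_trans (card_image_le _ _) _; exact: countableP.
  by apply: subset_card_le => _ [n [-> _]]; exists n.
Qed.

(** A ladder system on [S]: for [a] in [S] the ladder of [a] is cofinal in [a]
    and finite below every smaller point.  The ladder of [a] is empty for [a]
    outside [S], and ladders are disjoint from [S]. *)
Record ladder_system (S : set W) (c : W -> set W) := LadderSystem {
  ladder_dom : forall a x, c a x -> S a;
  ladder_lt : forall a x, c a x -> (x < a)%O;
  ladder_notin : forall a x, c a x -> ~ S x;
  ladder_fin : forall a y, (y < a)%O -> finite_set (c a `&` [set x | (x <= y)%O]);
  ladder_countable : forall a, countable (c a);
  ladder_cof : forall a y, S a -> (y < a)%O -> exists2 x, c a x & (y < x)%O;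
  ladder_pos : forall a, S a -> exists y, (y < a)%O }.

Lemma cof_omega_limit a : has_cofinality (below a) nat ->
  is_limit a /\ exists u : nat -> W,
    (forall n, (u n < a)%O) /\ (forall x, (x < a)%O -> exists n, (x <= u n)%O).
Proof.
move=> [[A Acof Anat] cmin]; split.
  move=> x xa; apply: contrapT => nlim.
  have /cmin : cofinal [set (exist _ x xa : {x : W | (x < a)%O}) : below a].
    move=> z; exists (exist _ x xa : {x : W | (x < a)%O}) => //.
    case: z => z za; rewrite leEsub /= leNgt; apply/negP => xz.
    by apply: nlim; exists z.
  by move=> /infiniteP; apply; exact: finite_set1.
have A0 : A !=set0.
  apply/set0P/negP => /eqP A0; move: Anat; rewrite A0 card_eq_sym card_eq0.
  by move=> /eqP/seteqP[/(_ 0%N)/(_ Logic.I)].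
have [|u [uA Au]] := countable_cofinal_seq _ A0.
  by move: Anat; rewrite card_eq_le => /andP[].
exists (fun n => \val (u n : {x : W | (x < a)%O})); split.
  by move=> n; exact: (valP (u n : {x : W | (x < a)%O})).
move=> x xa; have [y Ay xy] := Acof (exist _ x xa : {x : W | (x < a)%O}).
by have [n un] := Au _ Ay; exists n; rewrite un.
Qed.

Lemma ladder_system_exists (S : set W) :
  (forall a, S a -> has_cofinality (below a) nat) -> exists c, ladder_system S c.
Proof.
move=> Scof.
have /choice[c cP] : forall a, exists c : set W,
   [/\ forall x, c x -> S a /\ (x < a)%O, forall x, c x -> is_succ x,
    forall y, (y < a)%O -> finite_set (c `&` [set x | (x <= y)%O]),
    forall y, S a -> (y < a)%O -> exists2 x, c x & (y < x)%O & countable c].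
  move=> a; have [Sa|nSa] := pselect (S a); last first.
    by exists set0; split=> // y _; rewrite set0I.
  have [la [u [ua ucof]]] := cof_omega_limit (Scof _ Sa).
  have [c [ca cs cfin ccof ccount]] := ladder_exists la ua ucof.
  by exists c; split=> // [x /ca|y _ /ccof].
exists c; split.
- by move=> a x cx; have [/(_ _ cx)[]] := cP a.
- by move=> a x cx; have [/(_ _ cx)[]] := cP a.
- move=> a x cx Sx; have [_ /(_ _ cx) xs _ _ _] := cP a.
  by have [/limit_not_succ lx _] := cof_omega_limit (Scof _ Sx); exact: (lx xs).
- by move=> a y ya; have [_ _ + _ _] := cP a; exact.
- by move=> a; have [] := cP a.
- by move=> a y Sa ya; have [_ _ _ + _] := cP a; exact.
- move=> a /Scof/cof_omega_limit[_ [u [ua _]]]; by exists (u 0%N).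
Qed.

(** The ladders up to [b] can be made pairwise disjoint by removing an initial
    segment from each of them. *)
Definition disjointifiable (S : set W) (c : W -> set W) b := exists g : W -> W,
  (forall a, S a -> (a <= b)%O -> (g a < a)%O) /\
  (forall a a' x, S a -> S a' -> (a <= b)%O -> (a' <= b)%O ->
     c a x -> c a' x -> (g a < x)%O -> (g a' < x)%O -> a = a').

Section disjointify.
Context (S : set W) (c : W -> set W) (cS : ladder_system S c).

(** The ladders of points in different gaps of [E] are separated by the lower
    ends of the gaps; within a gap, the disjointification at its upper end is
    used. *)
Lemma disjointifiable_club b (E : set W) :
  (forall x, (x < b)%O -> exists2 e, E e & (x <= e)%O) ->
  (forall e, E e -> (e < b)%O) ->
  (forall a, S a -> (a < b)%O ->
     exists2 y, (y < a)%O & forall e, E e -> (e <= a)%O -> (e <= y)%O) ->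
  (S b -> E = c b) ->
  (forall e, (e < b)%O -> disjointifiable S c e) -> disjointifiable S c b.
Proof.
move=> Ecof Eb Egap Sb IH.
have /choice[ee eP] : forall a, exists e, (a < b)%O ->
    [/\ E e, (a <= e)%O & forall e', E e' -> (a <= e')%O -> (e <= e')%O].
  move=> a; have [ab|] := pselect (a < b)%O; last by exists a.
  have [e Ee ae] := Ecof _ ab.
  have [|m [Em am] mmin] := @wo_least _ _ wo [set e | E e /\ (a <= e)%O].
    by exists e.
  by exists m => _; split=> // e' Ee' ae'; apply: mmin.
have /choice[y yP] : forall a, exists y, S a -> (a < b)%O -> (y < a)%O /\
    forall e, E e -> (e <= a)%O -> (e <= y)%O.
  move=> a; have [Sa|] := pselect (S a); last by exists a.
  have [ab|] := pselect (a < b)%O; last by exists a.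
  by have [y ya yE] := Egap _ Sa ab; exists y.
have /choice[h hP] : forall e, exists h : W -> W, (e < b)%O ->
    (forall a, S a -> (a <= e)%O -> (h a < a)%O) /\
    (forall a a' x, S a -> S a' -> (a <= e)%O -> (a' <= e)%O ->
     c a x -> c a' x -> (h a < x)%O -> (h a' < x)%O -> a = a').
  move=> e; have [/IH[h hP]|] := pselect (e < b)%O; first by exists h.
  by exists id.
have /choice[lo loP] : forall a, exists y, S a -> (y < a)%O.
  move=> a; have [/(ladder_pos cS)[y0 ya]|] := pselect (S a); first by exists y0.
  by exists a.
exists (fun a => if (a < b)%O then Order.max (y a) (h (ee a) a) else lo a).
have key a a' x : S a -> S a' -> (a < b)%O -> (a' < b)%O -> (a <= a')%O ->
    c a x -> c a' x -> (Order.max (y a) (h (ee a) a) < x)%O ->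
    (Order.max (y a') (h (ee a') a') < x)%O -> a = a'.
  move=> Sa Sa' ab a'b aa' cx c'x; rewrite !gt_max => /andP[yx hx] /andP[y'x h'x].
  have [Ee ae emin] := eP _ ab; have [Ee' ae' emin'] := eP _ a'b.
  have [a'e|ea'] := leP a' (ee a).
    have ee' : ee a = ee a'.
      by apply/le_anti; rewrite emin'// andbT emin// (le_trans aa').
    have [_ hdisj] := hP _ (Eb _ Ee).
    by apply: (hdisj _ _ x) => //; rewrite ee'.
  have [_ /(_ _ Ee (ltW ea')) ey] := yP _ Sa' a'b.
  have := ladder_lt cS cx; rewrite ltNge => /negP[].
  exact: le_trans ae (le_trans ey (ltW y'x)).
have keyb a x : S a -> (a < b)%O -> S b -> c a x -> c b x ->
    (Order.max (y a) (h (ee a) a) < x)%O -> False.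
  move=> Sa ab /[dup] Sb' /Sb Eb' cx cbx; rewrite gt_max => /andP[yx _].
  have [_ /(_ x)] := yP _ Sa ab; rewrite Eb' => /(_ cbx (ltW (ladder_lt cS cx))).
  by rewrite leNgt yx.
split=> [a Sa ab|a a' x Sa Sa' ab a'b cx c'x].
  case: ifPn => [ab'|_]; last exact: loP.
  rewrite gt_max (yP _ Sa ab').1/=; have [Ee ae _] := eP _ ab'.
  by have [+ _] := hP _ (Eb _ Ee); apply.
case: ifPn => [ab'|ab']; case: ifPn => [a'b'|a'b'].
- move=> ax a'x; have [aa'|/ltW a'a] := leP a a'; first exact: (key _ _ x).
  by apply/esym; apply: (key _ _ x).
- have a'E : a' = b by apply/le_anti; rewrite a'b leNgt a'b'.
  by rewrite a'E in Sa' c'x * => /(keyb _ x Sa ab' Sa' cx c'x).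
- have aE : a = b by apply/le_anti; rewrite ab leNgt ab'.
  by rewrite aE in Sa cx * => _ /(keyb _ x Sa' a'b' Sa c'x cx).
- by move=> _ _; apply/le_anti; rewrite (le_trans ab)//= ?(le_trans a'b)// leNgt.
Qed.

(** If [E] is finite up to [a] and disjoint from [S], then [a] lies in a gap of
    [E]. *)
Lemma ladder_gap (E : set W) a :
  (forall x, E x -> ~ S x) -> finite_set (E `&` [set x | (x <= a)%O]) ->
  S a -> exists2 y, (y < a)%O & forall e, E e -> (e <= a)%O -> (e <= y)%O.
Proof.
move=> ES Efin Sa; have [a0 a0a] := ladder_pos cS Sa.
have [|y ya yP] := finite_below_bounded a0a Efin.
  move=> x [Ex /= xa]; rewrite lt_neqAle xa andbT; apply/eqP => xE.
  by apply: (ES x) => //; rewrite xE.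
by exists y => // e Ee ea; apply: yP.
Qed.

End disjointify.
End ladder.

Section nonreflecting.
Context {d1 : Order.disp_t} {W1 : orderType d1} {d2 : Order.disp_t} {W2 : orderType d2}.
Context (hW1 : is_omega1 W1) (hW2 : is_successor_cardinal W1 W2).
Context (S : set W2) (S_cof : forall a : W2, S a -> has_cofinality (below a) nat).
Context (S_nonrefl : forall b : W2,
  has_cofinality (below b) W1 -> ~ stationary (trace S b)).
Context (c : W2 -> set W2) (cS : ladder_system S c).

Let wo : well_ordered W2. Proof. by case: hW2. Qed.

Let W1abs : absorbing W1.
Proof. exact: (succ_card_absorbing absorbing_nat hW1). Qed.

(** A nonzero [b] without a cofinal sequence, not even a constant one, has
    cofinality omega_1. *)
Lemma cof_omega1 (b x0 : W2) : (x0 < b)%O ->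
  ~ (exists u : nat -> W2, (forall n, (u n < b)%O) /\
      (forall x, (x < b)%O -> exists n, (x <= u n)%O)) ->
  has_cofinality (below b) W1.
Proof.
move=> x0b nu.
have big (A : set (below b)) : cofinal A -> [set: W1] #<= A.
  move=> Acof; apply: (succ_card_min hW1) => Acount; apply: nu.
  have A0 : A !=set0.
    by have [y Ay _] := Acof (exist _ x0 x0b : {x : W2 | (x < b)%O}); exists y.
  have [u [uA Au]] := countable_cofinal_seq Acount A0.
  exists (fun n => \val (u n : {x : W2 | (x < b)%O})); split.
    by move=> n; exact: (valP (u n : {x : W2 | (x < b)%O})).
  move=> x xb; have [y Ay xy] := Acof (exist _ x xb : {x : W2 | (x < b)%O}).
  by have [n un] := Au _ Ay; exists n; rewrite un.
split=> //; exists setT; first by move=> x; exists x.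
rewrite card_eq_le big ?andbT; last by move=> x; exists x.
by case: hW2.
Qed.

(** Induction on [b], with [disjointifiable_club] applied to the ladder of [b] if
    [b] is in [S], to a cofinal omega-sequence of successors if [b] has
    cofinality omega and is not in [S], and to a closed unbounded subset of [b]
    disjoint from [S] if [b] has cofinality omega_1. *)
Lemma nonreflecting_disjointifiable b : disjointifiable S c b.
Proof.
elim/(wo_ind wo): b => b IH.
have [Sb|nSb] := pselect (S b).
  apply: (disjointifiable_club wo cS (E := c b)) => //.
  - by move=> x xb; have [y cy xy] := ladder_cof cS Sb xb; exists y => //; exact: ltW.
  - by move=> e; exact: (ladder_lt cS).
  - move=> a Sa ab; apply: (ladder_gap cS) => //; last exact: (ladder_fin cS).
    by move=> x; exact: (ladder_notin cS).
have [[x0 x0b]|nx] := pselect (exists x, (x < b)%O); last first.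
  apply: (disjointifiable_club wo cS (E := set0)) => //.
  - by move=> x xb; case: nx; exists x.
  - by move=> a _ ab; case: nx; exists a.
have [lb|nlb] := pselect (is_limit b); last first.
  have [e eb emax] : is_succ b.
    move: nlb => /existsNP[y /not_implyP[yb ny]]; exists y => // z zb.
    by rewrite leNgt; apply/negP => yz; apply: ny; exists z.
  have [g [gP gdisj]] := IH _ eb.
  have bE a : S a -> (a <= b)%O -> (a <= e)%O.
    by move=> Sa; rewrite le_eqVlt => /predU1P[ab|/emax//]; case: nSb; rewrite -ab.
  exists g; split=> [a Sa /(bE _ Sa)|a a' x Sa Sa' /(bE _ Sa) ? /(bE _ Sa')]; first exact: gP.
  exact: gdisj.
have [[u [ub ucof]]|/(cof_omega1 x0b)/S_nonrefl nstat] := pselect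
    (exists u : nat -> W2, (forall n, (u n < b)%O) /\
      (forall x, (x < b)%O -> exists n, (x <= u n)%O)).
  have [E [Eb Es Efin Ecof _]] := ladder_exists wo lb ub ucof.
  apply: (disjointifiable_club wo cS (E := E)) => //.
  - by move=> x /Ecof[y Ey xy]; exists y => //; exact: ltW.
  - move=> a Sa ab; apply: (ladder_gap cS) => //; last exact: Efin.
    by move=> x /Es xs /S_cof/cof_omega_limit[/limit_not_succ lx _]; exact: (lx xs).
move: nstat => /existsNP[F /not_implyP[Fcl /not_implyP[Fub FS]]].
pose E := [set \val (x : {x : W2 | (x < b)%O}) | x in F].
apply: (disjointifiable_club wo cS (E := E)) => //.
- move=> x xb; have [y Fy xy] := Fub (exist _ x xb : {x : W2 | (x < b)%O}).
  by exists (\val (y : {x : W2 | (x < b)%O})); [exists y|exact: ltW].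
- by move=> _ [x _ <-]; exact: (valP (x : {x : W2 | (x < b)%O})).
- move=> a Sa ab; have [a0 a0a] := ladder_pos cS Sa.
  pose a' : below b := (exist _ a ab : {x : W2 | (x < b)%O}).
  pose a0' : below b := (exist _ a0 (lt_trans a0a ab) : {x : W2 | (x < b)%O}).
  have [||y ya yP] := @order_closed_gap _ _ F a' a0' Fcl.
  + by move=> Fa; apply: FS; exists a'.
  + by rewrite ltEsub.
  exists (\val (y : {x : W2 | (x < b)%O})) => //.
  by move=> _ [x Fx <-] xa; exact: yP.
Qed.

End nonreflecting.

(** * Uniformly closed spaces of bounded functions *)

(** A vector space of bounded real functions on [T], closed under uniform
    limits. *)
Record function_space (R : realType) (T : Type) := FunctionSpace {
  fs_pred : {pred T -> R} ;
  fs_submod : submod_closed fs_pred ;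
  fs_bounded : forall f, f \in fs_pred -> exists M, forall t, `|f t| <= M ;
  fs_closed : forall f,
    (forall e, 0 < e -> exists2 g, g \in fs_pred & forall t, `|f t - g t| <= e) ->
    f \in fs_pred }.

Arguments fs_submod {R T} V : rename.

Section function_space_banach.
Context {R : realType} {T : Type} (V : function_space R T).

Definition fs_sort := {f : T -> R | f \in fs_pred V}.

HB.instance Definition _ := SubChoice.on fs_sort.
HB.instance Definition _ := GRing.SubChoice_isSubLmodule.Build R (T -> R)
  (fs_pred V) fs_sort (fs_submod V).

Definition fs_eval (f : fs_sort) (t : T) : R := val f t.

(** The supremum norm; the supremum of the empty set is 0, which makes it right
    for an empty [T] as well. *)
Definition fs_norm (f : fs_sort) : R := sup [set `|fs_eval f t| | t in setT].

Lemma fs_evalD f g t : fs_eval (f + g) t = fs_eval f t + fs_eval g t.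
Proof. by []. Qed.

Lemma fs_evalZ a f t : fs_eval (a *: f) t = a * fs_eval f t.
Proof. by []. Qed.

Lemma fs_eval_le f t : `|fs_eval f t| <= fs_norm f.
Proof.
apply: ub_le_sup; last by exists t.
have [M fM] := fs_bounded (valP f).
by exists M => _ [u _ <-]; exact: fM.
Qed.

Lemma fs_norm_le f r : 0 <= r -> (forall t, `|fs_eval f t| <= r) -> fs_norm f <= r.
Proof.
move=> r0 fr; have [E0|/set0P E0] := eqVneq [set `|fs_eval f t| | t in setT] set0.
  by rewrite /fs_norm E0 sup0.
by apply: ge_sup => // _ [t _ <-].
Qed.

Lemma fs_norm_ge0 f : 0 <= fs_norm f.
Proof.
have [E0|/set0P[_ [t _ _]]] := eqVneq [set `|fs_eval f t| | t in setT] set0.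
  by rewrite /fs_norm E0 sup0.
by apply: le_trans (fs_eval_le f t).
Qed.

Let ler_normD f g : fs_norm (f + g) <= fs_norm f + fs_norm g.
Proof.
apply: fs_norm_le => [|t]; first by rewrite addr_ge0// fs_norm_ge0.
by rewrite fs_evalD (le_trans (ler_normD _ _))// lerD// fs_eval_le.
Qed.

Let normrZ a f : fs_norm (a *: f) = `|a| * fs_norm f.
Proof.
have le b g : fs_norm (b *: g) <= `|b| * fs_norm g.
  apply: fs_norm_le => [|t]; first by rewrite mulr_ge0// fs_norm_ge0.
  by rewrite fs_evalZ normrM ler_wpM2l// fs_eval_le.
apply/le_anti; rewrite le/=; have [->|a0] := eqVneq a 0.
  by rewrite normr0 mul0r fs_norm_ge0.
have := le a^-1 (a *: f); rewrite scalerA mulVf// scale1r normfV.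
by rewrite ler_pdivlMl ?normr_gt0.
Qed.

Let normr0_eq0 f : fs_norm f = 0 -> f = 0.
Proof.
move=> f0; apply/val_inj/funext => t; apply/eqP.
by have := fs_eval_le f t; rewrite f0 normr_le0.
Qed.

HB.instance Definition _ :=
  Lmodule_isNormed.Build R fs_sort ler_normD normrZ normr0_eq0.

Lemma fs_complete (F : set_system fs_sort) : ProperFilter F -> cauchy F -> cvg F.
Proof.
move=> FF /cauchy_ballP Fc.
have close e : 0 < e -> exists2 A, F A & forall f g, A f -> A g -> `|f - g| < e.
  move=> e0; have [[A B] /= [FA FB] AB] := Fc _ e0.
  exists (A `&` B); first exact: filterI.
  by move=> f g [Af _] [_ Bg]; have := AB (f, g) (conj Af Bg); rewrite -ball_normE.
have cvt t : cvg (fs_eval ^~ t @ F).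
  apply: cauchy_cvg; apply/cauchy_ballP => e e0; have [A FA AP] := close _ e0.
  exists (fs_eval ^~ t @` A, fs_eval ^~ t @` A) => /=.
    suff: (fs_eval ^~ t @ F) (fs_eval ^~ t @` A) by split.
    by apply: (@filterS _ F _ A) => // f Af; exists f.
  move=> -[_ _] /= [[f Af <-] [g Ag <-]]; rewrite -ball_normE /=.
  apply: le_lt_trans (AP _ _ Af Ag); exact: (fs_eval_le (f - g)).
pose l t := lim (fs_eval ^~ t @ F).
have lP A e : F A -> (forall f g, A f -> A g -> `|f - g| < e) ->
    forall f t, A f -> `|l t - fs_eval f t| <= e.
  move=> FA AP f t Af; rewrite distrC.
  have cv : (fun g => `|fs_eval f t - fs_eval g t|) @ F --> `|fs_eval f t - l t|.
    by apply: cvg_norm; apply: cvgB; [exact: cvg_cst|exact: cvt].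
  rewrite -(cvg_lim _ cv)//; apply: limr_le; first by apply/cvg_ex; eexists; exact: cv.
  apply: filterS FA => g Ag; apply: le_trans (ltW (AP _ _ Af Ag)).
  exact: (fs_eval_le (f - g)).
have lV : l \in fs_pred V.
  apply: fs_closed => e e0; have [A FA AP] := close _ e0.
  have [f Af] := filter_ex FA; exists (val f); first exact: valP.
  by move=> t; exact: (lP A).
apply/cvg_ex; exists (exist _ l lV); apply/cvgrPdist_le => e e0.
have [A FA AP] := close _ e0; apply: (filterS _ FA) => f Af.
by apply: fs_norm_le => [|t]; [exact: ltW|exact: (lP A e FA AP f t Af)].
Qed.

HB.instance Definition _ := Uniform_isComplete.Build fs_sort fs_complete.

Definition fs_banach : completeNormedModType R := fs_sort.

End function_space_banach.

(** * Weak compactness *)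

Section weak_compactness.
Context {R : realType} {Z : normedModType R}.
Implicit Types (f : @dual R Z) (x y : Z).

Lemma dual_weak_continuous f : continuous (sval f : weak_topology Z -> R).
Proof.
move=> x; have /cvg_sup/(_ f) := @cvg_id (weak_topology Z) (nbhs (x : weak_topology Z)).
move=> xf A /(@initial_continuous _ _ (sval f : Z -> R)); exact: xf.
Qed.

Lemma dual_bounded f : exists2 M, 0 < M & forall x, `|sval f x| <= M * `|x|.
Proof.
have /linear_bounded_continuous/linear_boundedP := proj2_sig f.
by move=> /pinfty_ex_gt0[M M0 fM]; exists M.
Qed.

(** Every weak neighbourhood of 0 contains all but finitely many members of a
    family on which each functional tends to 0. *)
Lemma null_family_weakly_compact I (z : I -> Z) :
  (forall f e, 0 < e -> finite_set [set i | e <= `|sval f (z i)|]) ->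
  weakly_compact ([set 0] `|` range z).
Proof.
move=> znull F FF FC.
have [?|ncl] := pselect (cluster (F : set_system (weak_topology Z)) (0 : Z)).
  by exists 0; split=> //; left.
have [A [U [FA nU AU]]] : exists A U,
    [/\ F A, nbhs (0 : weak_topology Z) U & ~ ((A `&` U) !=set0)].
  move: ncl => /existsNP[A /existsNP[U /not_implyP[FA /not_implyP[nU AU]]]].
  by exists A, U.
(* The image under [z] of the cofinite filter converges weakly to 0. *)
pose G : set_system Z := [set B | finite_set [set i | ~ B (z i)]].
have GF : Filter G.
  split; rewrite /G /=.
  - by apply: sub_finite_set (finite_set0 I) => i /=; apply.
  - move=> B B' fB fB'; have : finite_set ([set i | ~ B (z i)] `|` [set i | ~ B' (z i)]).
      by rewrite finite_setU.
    apply: sub_finite_set => i /= /not_andP[]; [by left|by right].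
  - by move=> B B' BB'; apply: sub_finite_set => i /= nB' /BB'.
have Gcvg : G --> (0 : weak_topology Z).
  apply/cvg_sup => f V [/= _ [[B oB <-] Bf BV]].
  have /nbhs_ballP[e /= e0 eB] : nbhs (0 : R) B.
    by apply: open_nbhs_nbhs; split=> //; move: Bf; rewrite /= raddf0.
  apply: sub_finite_set (znull f e e0) => i /= nV; rewrite leNgt; apply/negP => lte.
  by apply: nV; apply: BV; apply: eB; rewrite -ball_normE /= sub0r normrN.
have Efin := Gcvg _ nU.
have Ecpt : compact (z @` [set i | ~ U (z i)] : set (weak_topology Z)).
  exact/finite_compact/finite_image.
have [|y [[i nUi <-] ycl]] := Ecpt F FF.
  apply: filterS (filterI FA FC) => y [Ay [y0|[i _ yi]]].
    case: AU; exists y; split=> //; rewrite y0; exact: (nbhs_singleton nU).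
  by exists i => //= Ui; apply: AU; exists y; split=> //; rewrite -yi.
by exists (z i); split=> //; right; exists i.
Qed.

(** A weak cluster point of a sequence in [C] takes the limit value at every
    functional along which the sequence converges. *)
Lemma weakly_compact_seq (C : set Z) (x : nat -> Z) :
  weakly_compact C -> (forall n, C (x n)) ->
  exists2 y, C y & forall f l, (sval f \o x) @ \oo --> (l : R) -> sval f y = l.
Proof.
move=> Cc xC; have [|y [Cy ycl]] := Cc (x @ \oo) _.
  by exists 0%N => // n _; exact: xC.
exists y => // f l fl; apply/eqP; rewrite -subr_eq0 -normr_le0; apply/ler_addgt0Pl => e e0.
rewrite addr0.
have e2 : 0 < e / 2 by rewrite divr_gt0.
have [||z [zl zy]] := ycl [set z | `|l - sval f z| < e / 2]
    [set z | `|sval f y - sval f z| < e / 2].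
- by move/cvgrPdist_lt: fl => /(_ _ e2).
- apply: (@dual_weak_continuous f y [set r | `|sval f y - r| < e / 2]).
  by apply/nbhs_ballP; exists (e / 2) => //= r; rewrite -ball_normE.
rewrite (splitr e); apply: le_trans (lerD (ltW zy) (ltW zl)).
rewrite [X in _ <= _ + X]distrC; apply: le_trans (ler_normD _ _).
by rewrite addrA subrK.
Qed.

End weak_compactness.

(** * Isometric coordinates *)

Lemma inv_succ_le {R : realType} (e : R) : 0 < e -> exists n : nat, n.+1%:R^-1 <= e.
Proof.
move=> e0; have [n en] := ltr_add_invr e0; exists n; move: en; rewrite add0r; exact: ltW.
Qed.

Lemma inv_succ_gt0 {R : realType} n : 0 < n.+1%:R^-1 :> R.
Proof. by rewrite invr_gt0. Qed.

(** [ev] identifies [Z] with a space of bounded functions on [T] under the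
    supremum norm.  The bound [r] in [norm_le_coord] is nonnegative because [T]
    may be empty. *)
Record sup_coordinates (R : realType) (Z : normedModType R) (T : Type)
    (ev : Z -> T -> R) : Prop := SupCoordinates {
  coordD : forall x y t, ev (x + y) t = ev x t + ev y t ;
  coordZ : forall a x t, ev (a *: x) t = a * ev x t ;
  coord_le : forall x t, `|ev x t| <= `|x| ;
  norm_le_coord : forall x r, 0 <= r -> (forall t, `|ev x t| <= r) -> `|x| <= r }.

Section sup_coordinates.
Context {R : realType} {Z : normedModType R} {T : Type} {ev : Z -> T -> R}.
Context (Zev : sup_coordinates ev).

Lemma coord_zero t : ev 0 t = 0.
Proof. by rewrite -[X in ev X](scale0r 0) (coordZ Zev) mul0r. Qed.

Lemma coordN x t : ev (- x) t = - ev x t.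
Proof. by rewrite -scaleN1r (coordZ Zev) mulN1r. Qed.

Lemma coordB x y t : ev (x - y) t = ev x t - ev y t.
Proof. by rewrite (coordD Zev) coordN. Qed.

Lemma coord_sum I (r : seq I) (P : pred I) (F : I -> Z) t :
  ev (\sum_(i <- r | P i) F i) t = \sum_(i <- r | P i) ev (F i) t.
Proof. by elim/big_ind2 : _ => [|x a y b <- <-|//]; rewrite ?coord_zero// (coordD Zev). Qed.

Lemma coord_dual t : exists f : @dual R Z, forall x, sval f x = ev x t.
Proof.
have lin : scalar (fun x => ev x t).
  by move=> a x y; rewrite (coordD Zev) (coordZ Zev).
pose f : {scalar Z} := HB.pack (fun x => ev x t : R^o)
  (GRing.isLinear.Build R Z R^o *%R (fun x => ev x t) lin).
have fc : continuous (f : Z -> R).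
  apply/linear_bounded_continuous/linear_boundedP.
  near=> r => x; apply: le_trans (coord_le Zev x t) _.
  by rewrite ler_peMl.
by exists (exist _ f fc).
Unshelve. all: by end_near. Qed.

End sup_coordinates.

Lemma fs_sup_coordinates (R : realType) T (V : function_space R T) :
  sup_coordinates (@fs_eval R T V : fs_banach V -> T -> R).
Proof.
split=> //; [exact: fs_eval_le|exact: fs_norm_le].
Qed.

Lemma subspace_sup_coordinates (R : realType) (X : completeNormedModType R) T
    (ev : X -> T -> R) (Y : closed_subspace X) :
  sup_coordinates ev ->
  sup_coordinates (fun (y : subspace_banach Y) t => ev (val y) t).
Proof.
move=> Xev; split=> [x y t|a x t|x t|x r r0 xr].
- exact: (coordD Xev).
- exact: (coordZ Xev).
- exact: (coord_le Xev).
- exact: (norm_le_coord Xev).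
Qed.

(** * Spaces that are c_0 over separable blocks *)

(** [p] maps the points of [T] to their blocks, which are indexed by omega_1.
    The elements of [Z] are [c_0] over the blocks, and on the block of [i] they
    are approximated by the sequence [Q i]. *)

Section block_decomposition.
Context {R : realType} {Z : completeNormedModType R} {T : Type} {ev : Z -> T -> R}.
Context (Zev : sup_coordinates ev).

(** The image of [Z] is closed under uniform limits. *)
Lemma coord_complete (g : T -> R) :
  (forall e, 0 < e -> exists z, forall t, `|ev z t - g t| <= e) ->
  exists z, forall t, ev z t = g t.
Proof.
move=> gP; have /choice[z zP] : forall n, exists z, forall t, `|ev z t - g t| <= n.+1%:R^-1.
  by move=> n; apply: gP; exact: inv_succ_gt0.
have zz n m e : n.+1%:R^-1 <= e -> m.+1%:R^-1 <= e -> `|z n - z m| <= e + e.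
  move=> ne me; have e0 : 0 <= e by exact: le_trans (ltW (inv_succ_gt0 n)) ne.
  apply: (norm_le_coord Zev) => [|t]; first by rewrite addr_ge0.
  rewrite (coordB Zev); have -> : ev (z n) t - ev (z m) t =
    (ev (z n) t - g t) - (ev (z m) t - g t) by lra.
  apply: le_trans (ler_normB _ _) _; apply: lerD.
    exact: le_trans (zP n t) ne.
  exact: le_trans (zP m t) me.
have mono (e : R) n m : n.+1%:R^-1 <= e -> (n <= m)%N -> m.+1%:R^-1 <= e.
  move=> ne nm; apply: le_trans ne; rewrite lef_pV2 ?posrE ?ltr0n//.
  by rewrite ler_nat.
have /cauchy_cvg/cvg_ex[l zl] : cauchy (z @ \oo).
  apply/cauchy_ballP => e e0; have e4 : 0 < e / 4 by rewrite divr_gt0.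
  have [n ne] := inv_succ_le e4.
  exists ([set z m | m in [set m | (n <= m)%N]], [set z m | m in [set m | (n <= m)%N]]).
    suff: (z @ \oo) [set z m | m in [set m | (n <= m)%N]] by split.
    by exists n => // m nm; exists m.
  move=> [_ _] /= [[m nm <-] [p np <-]]; rewrite -ball_normE /ball_ /=.
  apply: le_lt_trans (zz m p (e / 4) _ _) _; [exact: mono ne _|exact: mono ne _|lra].
exists l => t; apply/eqP; rewrite -subr_eq0 -normr_le0; apply/ler_addgt0Pl => e e0.
rewrite addr0; have e2 : 0 < e / 2 by rewrite divr_gt0.
have [n ne] := inv_succ_le e2.
move/cvgrPdist_lt : zl => /(_ _ e2)[N _ NP].
have := NP (maxn n N) (leq_maxr _ _); rewrite /= => lz.
have := zP (maxn n N) t => zg.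
have zg' := le_trans zg (mono _ _ _ ne (leq_maxl _ _)).
have := coord_le Zev (l - z (maxn n N)) t; rewrite (coordB Zev) => lz'.
have -> : ev l t - g t = (ev l t - ev (z (maxn n N)) t) + (ev (z (maxn n N)) t - g t) by lra.
apply: le_trans (ler_normD _ _) _; lra.
Qed.

Context {d : Order.disp_t} {W : orderType d} (hW : is_omega1 W) (p : T -> W).
Context (Q : W -> nat -> T -> R).
Hypothesis ev_c0 : forall z (e : R), 0 < e ->
  exists s : seq W, forall t, p t \notin s -> `|ev z t| <= e.
Hypothesis ev_separable : forall z i (e : R), 0 < e ->
  exists k, forall t, p t = i -> `|ev z t - Q i k t| <= e.

Let wo : well_ordered W. Proof. by case: hW. Qed.

Lemma coord_support_bounded z : exists b, forall t, (b <= p t)%O -> ev z t = 0.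
Proof.
have /choice[s sP] : forall n, exists s : seq W,
    forall t, p t \notin s -> `|ev z t| <= n.+1%:R^-1.
  by move=> n; apply: ev_c0; exact: inv_succ_gt0.
have [|b bP] := @succ_card_bounded _ absorbing_nat _ _ hW _
   (\bigcup_n [set i | i \in s n]) id.
  apply: bigcup_countable => [|n _]; first exact: countableP.
  exact/finite_set_countable/finite_seq.
exists b => t bt; apply/eqP; rewrite -normr_le0; apply/ler_addgt0Pl => e e0.
rewrite addr0; have [n ne] := inv_succ_le e0; apply: le_trans ne; apply: sP.
apply/negP => ps; move: bt; apply/negP; rewrite -ltNge; apply: bP.
by exists n.
Qed.

(** [z] realises the finite data [a]: its norm is at most [a.2], and it is close
    to [Q i k] on the block of [i] for each pair [(i, k)] in [a.1]. *)
Definition witness (a : seq (W * nat) * nat) (z : Z) :=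
  `|z| <= a.2%:R /\ forall q, q \in a.1 -> forall t, p t = q.1 ->
    `|ev z t - Q q.1 q.2 t| <= a.2.+1%:R^-1.

(** The function [b] bounds the indices of the blocks that meet the support of
    one witness, for all data that have a witness. *)
Lemma witness_bound : exists b : seq (W * nat) * nat -> W, forall a z,
  witness a z -> exists2 y, witness a y & forall t, (b a <= p t)%O -> ev y t = 0.
Proof.
suff /choice[b bP] : forall a, exists b, forall z, witness a z ->
    exists2 y, witness a y & forall t, (b <= p t)%O -> ev y t = 0 by exists b.
move=> a; have [[z az]|nz] := pselect (exists z, witness a z).
  by have [b bP] := coord_support_bounded z; exists b => _ _; exists z.
by have [b _] := coord_support_bounded 0; exists b => z az; case: nz; exists z.
Qed.

(** Suppose that every finite part of [A] lies in an initial segment that is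
    contained in [A] and bounded by a point closed under [b].  Then the
    restriction of [z] to the blocks in [A] is approximated by an average of [N]
    witnesses supported on [A].  Each of them approximates [z] on
    a finite set of blocks off which [z] and the previous witnesses are small,
    so at any given point at most one of them is far from [z]. *)
Lemma restriction_approx (b : seq (W * nat) * nat -> W) (A : set W) z e :
  (forall a z, witness a z ->
     exists2 y, witness a y & forall t, (b a <= p t)%O -> ev y t = 0) ->
  (forall s : seq W, (forall i, i \in s -> A i) -> exists2 x, closed_under b x &
     (forall i, i \in s -> (i < x)%O) /\ (forall i, (i < x)%O -> A i)) ->
  0 < e -> exists y, forall t, `|ev y t - (if p t \in A then ev z t else 0)| <= e.
Proof.
move=> bP AP e0; have e4 : 0 < e / 4 by rewrite divr_gt0.
have [n [zn ne]] : exists n : nat, `|z| <= n%:R /\ n.+1%:R^-1 <= e / 4.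
  have [n1 n1e] := inv_succ_le e4.
  exists (maxn n1 (Num.bound `|z|)); split.
    apply: le_trans (ltW (archi_boundP (normr_ge0 z))) _.
    by rewrite ler_nat leq_maxr.
  apply: le_trans n1e; rewrite lef_pV2 ?posrE ?ltr0n//.
  by rewrite ler_nat ltnS leq_maxl.
set h : R := n.+1%:R^-1 in ne; have h0 : 0 < h by exact: inv_succ_gt0.
have step (J : seq W) : (forall i, i \in J -> A i) -> exists y,
   [/\ `|y| <= n%:R, forall t, p t \in J -> `|ev y t - ev z t| <= 2 * h &
     forall t, p t \notin A -> ev y t = 0].
  move=> JA; have [x Fx [Jx xA]] := AP _ JA.
  have /choice[k kP] : forall i, exists k, forall t, p t = i -> `|ev z t - Q i k t| <= h.
    by move=> i; exact: ev_separable.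
  pose a := ([seq (i, k i) | i <- J], n).
  have /bP[y [yn yQ] y0] : witness a z.
    by split=> // _ /mapP[i iJ ->] t /= pt; exact: kP.
  exists y; split=> // t.
    move=> ptJ; have := yQ (p t, k (p t)) (map_f _ ptJ) t erefl.
    have := kP (p t) t erefl; rewrite /= -/h => zQ yQ'.
    have -> : ev y t - ev z t =
      (ev y t - Q (p t) (k (p t)) t) - (ev z t - Q (p t) (k (p t)) t) by lra.
    apply: le_trans (ler_normB _ _) _; lra.
  move=> /negP ptA; apply: y0; rewrite leNgt; apply/negP => ptb; apply: ptA.
  apply/mem_set/xA; apply: lt_le_trans ptb _; apply: Fx => q /mapP[i iJ ->].
  exact: Jx.
have filt (y : Z) : exists J : seq W, (forall i, i \in J -> A i) /\
    forall t, p t \in A -> p t \notin J -> `|ev y t| <= h.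
  have [J JP] := ev_c0 y h0; exists [seq i <- J | i \in A]; split.
    by move=> i; rewrite mem_filter => /andP[/set_mem].
  by move=> t tA; rewrite mem_filter tA /=; exact: JP.
have [J0 [J0A J0P]] := filt z.
(* [S] is the sum of the first [N] witnesses, [J] the union of the finite sets
   of blocks used so far; the term [2 * n] accounts for one bad witness. *)
have main N : exists (J : seq W) (S : Z), [/\ forall i, i \in J -> A i,
    {subset J0 <= J}, forall t, p t \notin A -> ev S t = 0 &
    forall t, p t \in A -> `|ev S t - N%:R * ev z t| <=
      2 * h * N%:R + (if p t \in J then 2 * n%:R else 0)].
  elim: N => [|N [J [S [JA J0J SA SP]]]].
    exists J0, 0; split=> // t _; first by rewrite (coord_zero Zev).
    by rewrite (coord_zero Zev) mul0r subrr normr0 mulr0 add0r; case: ifP.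
  have [y [yn yJ yA]] := step J JA.
  have [J1 [J1A J1P]] := filt y.
  exists (J ++ J1), (S + y); split.
  - by move=> i; rewrite mem_cat => /orP[/JA|/J1A].
  - by move=> i /J0J iJ; rewrite mem_cat iJ.
  - by move=> t tA; rewrite (coordD Zev) SA// yA// addr0.
  move=> t tA; rewrite (coordD Zev) -natr1 mem_cat.
  have -> : ev S t + ev y t - (N%:R + 1) * ev z t =
     (ev S t - N%:R * ev z t) + (ev y t - ev z t) by lra.
  apply: le_trans (ler_normD _ _) _; have := SP t tA.
  case: ifPn => /= tJ.
    by have := yJ t tJ => ? ?; lra.
  have yz : `|ev y t - ev z t| <= `|ev y t| + `|ev z t| := ler_normB _ _.
  have := le_trans (coord_le Zev y t) yn; have := le_trans (coord_le Zev z t) zn.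
  case: ifPn => tJ1; first by lra.
  have := J1P t tA tJ1; have := J0P t tA (contra (J0J _) tJ).
  lra.
have [N [N0 Ne]] : exists N : nat, (0 < N)%N /\ 2 * n%:R <= e / 2 * N%:R.
  exists (Num.bound (2 * n%:R / (e / 2))).+1; split=> //.
  rewrite [leRHS]mulrC -ler_pdivrMr ?divr_gt0//.
  have x0 : 0 <= 2 * n%:R / (e / 2) by rewrite !mulr_ge0 ?invr_ge0 ?mulr_ge0 ?(ltW e0).
  by apply: le_trans (ltW (archi_boundP x0)) _; rewrite ler_nat.
have [J [S [JA _ SA SP]]] := main N.
have N0' : 0 < N%:R :> R by rewrite ltr0n.
exists (N%:R^-1 *: S) => t; rewrite (coordZ Zev); case: ifPn => tA; last first.
  by rewrite SA// mulr0 subrr normr0 ltW.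
have -> : N%:R^-1 * ev S t - ev z t = N%:R^-1 * (ev S t - N%:R * ev z t).
  by rewrite mulrBr mulKf ?gt_eqF.
rewrite normrM gtr0_norm ?invr_gt0// ler_pdivrMl//.
apply: le_trans (SP t tA) _.
have h1 : 2 * h * N%:R <= e / 2 * N%:R by rewrite ler_wpM2r ?(ltW N0')//; lra.
have h2 : 0 <= e / 2 * N%:R by rewrite mulr_ge0 ?divr_ge0 ?(ltW e0)// ltW.
by case: ifP => _; lra.
Qed.

(** The blocks are grouped into countable intervals, the fibres of [nu], such
    that restricting to a group maps [Z] to itself.  Here [nu i] is the least
    point above [i] that is closed under the witness function. *)
Lemma coarse_blocks : exists nu : W -> W, (forall i, (i < nu i)%O) /\
  forall x z, exists y, forall t, ev y t = if nu (p t) == x then ev z t else 0.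
Proof.
have [b bP] := witness_bound.
have /choice[nu nuP] : forall i, exists x, [/\ closed_under b x, (i < x)%O &
    forall y, closed_under b y -> (i < y)%O -> (x <= y)%O].
  move=> i; have [x Fx ix] := closed_under_unbounded absorbing_nat hW b i.
  have [|m [Fm im] mmin] := @wo_least _ _ wo [set x | closed_under b x /\ (i < x)%O].
    by exists x.
  by exists m; split=> // y Fy iy; exact: mmin.
have nu_mono i j : (i < nu j)%O -> (nu i <= nu j)%O.
  by move=> ij; have [_ _] := nuP i; apply=> //; have [] := nuP j.
have restr (A : set W) z : (forall i j, A i -> (nu j <= nu i)%O -> A j) ->
    exists y, forall t, ev y t = if p t \in A then ev z t else 0.
  move=> Adown; apply: coord_complete => e e0.
  have [A0|/set0P[i0 Ai0]] := eqVneq A set0.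
    by exists 0 => t; rewrite (coord_zero Zev) A0 in_set0 subrr normr0 ltW.
  apply: (restriction_approx (b := b)) => //.
  move=> s sA; have [m Am mP] : exists2 m, A m & forall i, i \in s -> (i < nu m)%O.
    elim: s sA => [|j s IH] sA; first by exists i0.
    have [|m Am mP] := IH; first by move=> i is_; apply: sA; rewrite in_cons is_ orbT.
    have Aj : A j by apply: sA; rewrite mem_head.
    have [jm|mj] := leP (nu j) (nu m).
      exists m => // i; rewrite in_cons => /predU1P[->|/mP//].
      by apply: lt_le_trans jm; have [] := nuP j.
    exists j => // i; rewrite in_cons => /predU1P[->|/mP im].
      by have [] := nuP j.
    exact: lt_trans im mj.
  exists (nu m); first by have [] := nuP m.
  by split=> // i im; apply: Adown Am _; exact: nu_mono.
exists nu; split=> [i|x z]; first by have [] := nuP i.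
have [y yP] := restr [set i | (nu i <= x)%O] z (fun i j ix ji => le_trans ji ix).
have [y' yP'] := restr [set i | (nu i < x)%O] z (fun i j ix ji => le_lt_trans ji ix).
exists (y - y') => t; rewrite (coordB Zev) yP yP'.
have inb (P : W -> bool) i : (i \in [set j | P j]) = P i.
  by apply/idP/idP; rewrite inE.
by rewrite !inb; case: ltgtP => _; rewrite ?subrr ?subr0.
Qed.

(** The elements of [Z] that live on one group of blocks form a separable
    space. *)
Lemma coarse_block_dense (nu : W -> W) x : (forall i, (i < nu i)%O) ->
  exists u : nat -> Z, (forall k t, nu (p t) != x -> ev (u k) t = 0) /\
    forall z e, 0 < e -> (forall t, nu (p t) != x -> ev z t = 0) ->
      exists k, `|z - u k| <= e.
Proof.
move=> nu_gt.
pose good (a : seq (W * nat) * nat) z := [/\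
  forall t, nu (p t) != x -> ev z t = 0,
  forall q, q \in a.1 -> forall t, p t = q.1 -> `|ev z t - Q q.1 q.2 t| <= a.2.+1%:R^-1 &
  forall t, p t \notin [seq q.1 | q <- a.1] -> `|ev z t| <= a.2.+1%:R^-1].
have /choice[w wP] : forall a, exists w, (forall t, nu (p t) != x -> ev w t = 0) /\
    ((exists z, good a z) -> good a w).
  move=> a; have [[z az]|nz] := pselect (exists z, good a z).
    by exists z; split=> //; case: az.
  by exists 0; split=> // t _; rewrite (coord_zero Zev).
pose D : set (seq (W * nat) * nat) :=
  [set s | forall q, q \in s -> ([set i | (i < x)%O] `*` [set: nat]) q] `*` setT.
have Dc : countable D.
  apply: (card_setX_le absorbing_nat); last exact: countableP.
  apply: (card_seq_le absorbing_nat); apply: (card_setX_le absorbing_nat).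
    exact: (card_below_le hW).
  exact: countableP.
have [|u [uD Du]] := countable_cofinal_seq Dc; first by exists ([::], 0%N).
exists (w \o u); split=> [k|z e e0 zx]; first exact: (wP _).1.
have e2 : 0 < e / 2 by rewrite divr_gt0.
have [n ne] := inv_succ_le e2.
have [J JP] := ev_c0 z (inv_succ_gt0 n).
have /choice[k kP] : forall i, exists k, forall t,
    p t = i -> `|ev z t - Q i k t| <= n.+1%:R^-1.
  by move=> i; apply: ev_separable; exact: inv_succ_gt0.
pose a := ([seq (i, k i) | i <- [seq i <- J | nu i == x]], n).
have za : good a z.
  split=> // [_ /mapP[i _ ->] t /= pt|t]; first exact: kP.
  rewrite /= -map_comp map_id_in// mem_filter negb_and => /orP[/zx->|/JP//].
  by rewrite normr0 ltW// inv_succ_gt0.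
have [|m um] := Du a.
  split=> //= _ /mapP[i + ->]; rewrite mem_filter => /andP[/eqP <- _].
  by split=> //=; exact: nu_gt.
have [wx wQ wJ] : good a (w a) by apply: (wP _).2; exists z.
have [_ zQ zJ] := za.
exists m; rewrite /= um; apply: (norm_le_coord Zev) => [|t]; first exact: ltW.
rewrite (coordB Zev).
have [/mapP[q qa ptq]|ptn] := boolP (p t \in [seq q.1 | q <- a.1]).
  have -> : ev z t - ev (w a) t = (ev z t - Q q.1 q.2 t) - (ev (w a) t - Q q.1 q.2 t) by lra.
  apply: le_trans (ler_normB _ _) _; rewrite [leRHS]splitr; apply: lerD.
    exact: le_trans (zQ q qa t ptq) ne.
  exact: le_trans (wQ q qa t ptq) ne.
apply: le_trans (ler_normB _ _) _; rewrite [leRHS]splitr; apply: lerD.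
  exact: le_trans (zJ t ptn) ne.
exact: le_trans (wJ t ptn) ne.
Qed.

(** A functional is absolutely summable over elements of the unit ball with
    disjoint supports, because their signed finite sums are in the unit ball. *)
Lemma disjoint_functional_finite (nu : T -> W) (z : W -> Z) (f : @dual R Z) e :
  0 < e -> (forall x, `|z x| <= 1) -> (forall x t, nu t != x -> ev (z x) t = 0) ->
  finite_set [set x | e <= `|sval f (z x)|].
Proof.
move=> e0 z1 zsupp; apply: contrapT => inf.
have [M M0 fM] := dual_bounded f.
have [s [s_uniq sA sM]] : exists s : seq W, [/\ uniq s,
    forall x, x \in s -> e <= `|sval f (z x)| & (Num.bound (M / e) <= size s)%N].
  have [X XA XM] := infinite_set_fset (Num.bound (M / e)) inf.
  exists (finmap.enum_fset X); split=> //; exact: finmap.fset_uniq.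
pose y := \sum_(x <- s) Num.sg (sval f (z x)) *: z x.
have y1 : `|y| <= 1.
  apply: (norm_le_coord Zev) => // t; rewrite (coord_sum Zev).
  have H x : x != nu t -> ev (Num.sg (sval f (z x)) *: z x) t = 0.
    by move=> xt; rewrite (coordZ Zev) zsupp ?mulr0// eq_sym.
  have [ts|ts] := boolP (nu t \in s); last first.
    rewrite big_seq big1 ?normr0// => x xs; apply: H.
    by apply: contraNneq ts => <-.
  rewrite (bigD1_seq _ ts s_uniq)/= big1 ?addr0 => [|x]; last exact: H.
  rewrite (coordZ Zev) normrM; apply: le_trans (z1 (nu t)).
  apply: le_trans (coord_le Zev _ t); rewrite ler_piMl// normr_sg.
  by case: (_ != _).
have fy : sval f y = \sum_(x <- s) `|sval f (z x)|.
  by rewrite /y linear_sum; apply: eq_bigr => x _; rewrite linearZ /= -normrEsg.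
have sR : M / e < (size s)%:R.
  have Me0 : 0 <= M / e by rewrite divr_ge0 ?ltW.
  by apply: lt_le_trans (archi_boundP Me0) _; rewrite ler_nat.
move: sR; rewrite ltr_pdivrMr// ltNge => /negP; apply.
have fyM : `|sval f y| <= M by apply: le_trans (fM y) _; rewrite ler_piMr// ltW.
apply: le_trans fyM; rewrite fy ger0_norm ?sumr_ge0// {fy y y1 sM s_uniq}.
elim: s sA => [|x s IH] sA; first by rewrite big_nil mul0r.
rewrite big_cons /= -natr1 mulrDl mul1r addrC lerD ?sA ?mem_head// IH// => x' x's.
by apply: sA; rewrite in_cons x's orbT.
Qed.

(** The generating set consists of 0 and of dense sequences in the parts of [Z]
    on the groups of blocks, the [k]-th terms being scaled to have norm at most
    [1 / (k + 1)]. *)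
Theorem c0_blocks_wcg : weakly_compactly_generated Z.
Proof.
have [nu [nu_gt nu_restr]] := coarse_blocks.
have /choice[u uP] : forall x, exists u : nat -> Z,
    (forall k t, nu (p t) != x -> ev (u k) t = 0) /\
    forall z e, 0 < e -> (forall t, nu (p t) != x -> ev z t = 0) ->
      exists k, `|z - u k| <= e.
  by move=> x; exact: coarse_block_dense.
pose a x k : R := k.+1%:R * (1 + `|u x k|).
have a_gt0 x k : 0 < a x k by rewrite mulr_gt0// ltr_pwDl.
pose g (i : W * nat) := (a i.1 i.2)^-1 *: u i.1 i.2.
have g_le x k : `|g (x, k)| <= k.+1%:R^-1.
  rewrite normrZ gtr0_norm ?invr_gt0//= /a invfM -mulrA ler_piMr ?invr_ge0//.
  by rewrite ler_pdivrMl ?ltr_pwDl// mulr1 lerDr.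
have g_supp k x t : nu (p t) != x -> ev (g (x, k)) t = 0.
  by move=> tx; rewrite (coordZ Zev) (uP x).1// mulr0.
exists ([set 0] `|` range g).
  apply: null_family_weakly_compact => f e e0.
  have [M M0 fM] := dual_bounded f.
  have [N NM] : exists N : nat, M / e < N%:R.
    exists (Num.bound (M / e)); apply: archi_boundP.
    by rewrite divr_ge0 ?ltW.
  apply: (@sub_finite_set _ _ (\bigcup_(k in `I_N)
      ((fun x => (x, k)) @` [set x | e <= `|sval f (g (x, k))|]))).
    move=> [x k] /= ef; exists k; last by exists x.
    rewrite /= ltnNge; apply/negP => Nk; move: ef; apply/negP; rewrite -ltNge.
    apply: le_lt_trans (fM _) _; apply: le_lt_trans (ler_wpM2l (ltW M0) (g_le x k)) _.
    rewrite ltr_pdivrMr// mulrC -ltr_pdivrMr//; apply: lt_le_trans NM _.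
    by rewrite ler_nat; apply: leq_trans Nk _.
  apply: bigcup_finite => [|k _]; first exact: finite_II.
  apply/finite_image/(@disjoint_functional_finite (nu \o p) (fun x => g (x, k)) f e e0).
    by move=> x; apply: le_trans (g_le x k) _; rewrite invf_le1 ?ltr0n// ler1n.
  by move=> x t /= tx; exact: g_supp.
rewrite eqEsubset; split=> // z _ B /nbhs_ballP[e /= e0 zB].
have e2 : 0 < e / 2 by rewrite divr_gt0.
have [J JP] := ev_c0 z e2.
pose D := undup [seq nu i | i <- J].
have /choice[k kP] : forall x, exists k, forall t,
    `|(if nu (p t) == x then ev z t else 0) - ev (u x k) t| <= e / 2.
  move=> x; have [y yP] := nu_restr x z.
  have [|k yk] := (uP x).2 y _ e2; first by move=> t /negbTE tx; rewrite yP tx.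
  by exists k => t; rewrite -yP -(coordB Zev); apply: le_trans (coord_le Zev _ t) yk.
pose y := \sum_(x <- D) u x (k x).
have zy : `|z - y| <= e / 2.
  apply: (norm_le_coord Zev) => [|t]; first exact: ltW.
  rewrite (coordB Zev) (coord_sum Zev).
  have [tD|tD] := boolP (nu (p t) \in D).
    rewrite (bigD1_seq _ tD (undup_uniq _))/= big1 ?addr0; last first.
      by move=> x xt; rewrite (uP x).1// eq_sym.
    by have := kP (nu (p t)) t; rewrite eqxx.
  rewrite big_seq big1 ?subr0.
    by apply: JP; apply: contra tD => tJ; rewrite mem_undup map_f.
  by move=> x xD; rewrite (uP x).1//; apply: contraNneq tD => ->.
exists y; split; last first.
  by apply: zB; rewrite -ball_normE /=; apply: le_lt_trans zy _; lra.
case: D @y zy => [|x0 D] y _.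
  exists 0%N, (fun=> 0), (fun=> 0); split; first by case.
  by rewrite /y big_nil big_ord0.
pose x_ (i : 'I_(size (x0 :: D))) := nth x0 (x0 :: D) i.
exists (size (x0 :: D)), (fun i => a (x_ i) (k (x_ i))), (fun i => g (x_ i, k (x_ i))).
split=> [i|]; first by right; exists (x_ i, k (x_ i)).
rewrite /y (big_nth x0) big_mkord; apply: eq_bigr => i _.
by rewrite /g /= scalerA mulfV ?gt_eqF// scale1r.
Qed.

End block_decomposition.

(** * The space spanned by a ladder system *)

Lemma dense_approx (R : realType) (X : normedModType R) (D : set X) :
  dense D <-> forall x (e : R), 0 < e -> exists2 y, D y & `|x - y| < e.
Proof.
split=> [Dd x e e0|DP O [x Ox] Oo].
  have [|y [yB Dy]] := Dd (interior (ball x e)) _ (@open_interior _ _).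
    by exists x; exact: nbhsx_ballx.
  by exists y => //; have := interior_subset yB; rewrite -ball_normE.
have /nbhs_ballP[e /= e0 eO] : nbhs x O by exact: open_nbhs_nbhs.
have [y Dy xy] := DP x e e0; exists y; split=> //.
by apply: eO; rewrite -ball_normE.
Qed.

Section ladder_space.
Context {R : realType} {d2 : Order.disp_t} {W2 : orderType d2}.
Context {S : set W2} (c : W2 -> set W2) (cS : ladder_system S c).
Implicit Types (a b g t : W2) (s : seq (W2 * R)) (f : W2 -> R).

(** The generator at [g]: the indicator of [g] together with its ladder. *)
Definition gen g t : R := `[< t = g \/ c g t >]%:R.

(** Finite linear combinations of generators, as lists of terms. *)
Definition comb s t : R := \sum_(q <- s) q.2 * gen q.1 t.

Lemma gen_self g : gen g g = 1.
Proof. by rewrite /gen asboolT//; left. Qed.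

Lemma gen_gt g t : (g < t)%O -> gen g t = 0.
Proof.
move=> gt; rewrite /gen asboolF// => -[tg|/(ladder_lt cS)]; last by rewrite ltNge (ltW gt).
by rewrite tg ltxx in gt.
Qed.

Lemma gen_le1 g t : `|gen g t| <= 1.
Proof. by rewrite /gen; case: asbool; rewrite ?normr1 ?normr0. Qed.

Lemma comb_cons q s t : comb (q :: s) t = q.2 * gen q.1 t + comb s t.
Proof. by rewrite /comb big_cons. Qed.

Lemma comb_nil t : comb [::] t = 0.
Proof. by rewrite /comb big_nil. Qed.

Lemma comb_cat s s' t : comb (s ++ s') t = comb s t + comb s' t.
Proof. by rewrite /comb big_cat. Qed.

Lemma comb_scale (r : R) s t : comb [seq (q.1, r * q.2) | q <- s] t = r * comb s t.
Proof.
by rewrite /comb big_map mulr_sumr; apply: eq_bigr => q _; rewrite mulrA.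
Qed.

Lemma comb_bounded s : exists M, forall t, `|comb s t| <= M.
Proof.
exists (\sum_(q <- s) `|q.2|) => t; apply: le_trans (ler_norm_sum _ _ _) _.
by apply: ler_sum => q _; rewrite normrM ler_piMr// gen_le1.
Qed.

(** The uniform closure of the linear span of the generators. *)
Definition in_span f := forall e : R, 0 < e ->
  exists s, forall t, `|f t - comb s t| <= e.

(** The uniform closure of the linear span of the [gen g] with [g < b]. *)
Definition in_span_below b f := forall e : R, 0 < e ->
  exists2 s, (forall q, q \in s -> (q.1 < b)%O) & forall t, `|f t - comb s t| <= e.

Lemma in_span_submod : submod_closed [pred f | `[< in_span f >]].
Proof.
split; first by apply/asboolP => e e0; exists [::] => t; rewrite comb_nil subrr normr0 ltW.
move=> r f h /asboolP fS /asboolP hS; apply/asboolP => e e0.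
have r0 : 0 < `|r| + 1 by rewrite ltr_wpDl.
have [|s sP] := fS (e / 2 / (`|r| + 1)); first by rewrite !divr_gt0.
have [|s' sP'] := hS (e / 2); first by rewrite divr_gt0.
exists ([seq (q.1, r * q.2) | q <- s] ++ s') => t.
rewrite comb_cat comb_scale.
have -> : (r *: f + h) t - (r * comb s t + comb s' t) =
    r * (f t - comb s t) + (h t - comb s' t).
  by rewrite mulrBr; have -> : (r *: f + h) t = r * f t + h t by []; lra.
apply: le_trans (ler_normD _ _) _; rewrite [leRHS]splitr; apply: lerD => //.
rewrite normrM; have := sP t; rewrite ler_pdivlMr// => sP1.
apply: le_trans sP1; rewrite mulrC ler_wpM2l// lerDl//.
Qed.

Lemma in_span_bounded f : f \in [pred f | `[< in_span f >]] ->
  exists M, forall t, `|f t| <= M.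
Proof.
move=> /asboolP/(_ 1 ltr01)[s sP]; have [M MP] := comb_bounded s.
exists (1 + M) => t; rewrite -[f t](subrK (comb s t)).
by apply: le_trans (ler_normD _ _) _; apply: lerD.
Qed.

Lemma in_span_closed f :
  (forall e, 0 < e -> exists2 h, h \in [pred f | `[< in_span f >]] &
    forall t, `|f t - h t| <= e) -> f \in [pred f | `[< in_span f >]].
Proof.
move=> fP; apply/asboolP => e e0; have e2 : 0 < e / 2 by rewrite divr_gt0.
have [h /asboolP/(_ _ e2)[s sP] hP] := fP _ e2; exists s => t.
have -> : f t - comb s t = (f t - h t) + (h t - comb s t) by rewrite addrA subrK.
by apply: le_trans (ler_normD _ _) _; rewrite [leRHS]splitr lerD.
Qed.

Definition ladder_function_space : function_space R W2 :=
  FunctionSpace in_span_submod in_span_bounded in_span_closed.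

(** The closed linear span of the generators, with the supremum norm. *)
Definition ladder_space : completeNormedModType R := fs_banach ladder_function_space.

Lemma in_spanP (f : ladder_space) : in_span (fs_eval f).
Proof. by have /asboolP := valP f. Qed.

Lemma in_span_ex f : in_span f -> exists x : ladder_space, forall t, fs_eval x t = f t.
Proof. by move=> fS; exists (exist _ f (asboolT fS)). Qed.

Lemma comb_in_span s : in_span (comb s).
Proof. by move=> e e0; exists s => t; rewrite subrr normr0 ltW. Qed.

Lemma gen_in_span g : in_span (gen g).
Proof.
move=> e e0; exists [:: (g, 1)] => t.
by rewrite comb_cons comb_nil addr0 mul1r subrr normr0 ltW.
Qed.

Lemma in_span_belowW b b' f : (b <= b')%O -> in_span_below b f -> in_span_below b' f.
Proof.
move=> bb' fb e /fb[s sb sP]; exists s => // q /sb qb; exact: lt_le_trans qb bb'.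
Qed.

Lemma in_span_below_eq0 b f t : in_span_below b f -> (b <= t)%O -> f t = 0.
Proof.
move=> fb bt; apply/eqP; rewrite -normr_le0; apply/ler_addgt0Pl => e e0; rewrite addr0.
have [s sb /(_ t)] := fb e e0.
rewrite (_ : comb s t = 0) ?subr0// /comb big_seq big1// => q /sb qb.
by rewrite gen_gt ?mulr0//; exact: lt_le_trans qb bt.
Qed.

Lemma gen_ladder_cvg a g : S a -> finite_set [set x | c a x /\ gen g x <> gen g a].
Proof.
move=> Sa; have [ga|ag|->] := ltgtP g a.
- apply: (@sub_finite_set _ _ (c a `&` [set x | (x <= g)%O])); last exact: (ladder_fin cS).
  move=> x [cx gx]; split=> //=; rewrite leNgt; apply/negP => xg; apply: gx.
  by rewrite !gen_gt.
- apply: (@sub_finite_set _ _ (c g `&` [set x | (x <= a)%O])); last exact: (ladder_fin cS).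
  move=> x [cx gx]; have xa := ladder_lt cS cx; split=> /=; last exact: ltW.
  apply: contrapT => ncx; apply: gx; rewrite /gen !asboolF//.
    by move=> [aE|/(ladder_notin cS)//]; rewrite aE ltxx in ag.
  by move=> [xE|//]; rewrite xE in xa; have := lt_trans xa ag; rewrite ltxx.
- apply: sub_finite_set (finite_set0 W2) => x [cx] /=; apply.
  by rewrite gen_self /gen asboolT//; right.
Qed.

(** Along the ladder of [a], a function in the span converges to its value at
    [a]. *)
Lemma in_span_ladder_cvg a f (e : R) : S a -> in_span f -> 0 < e ->
  finite_set [set x | c a x /\ e < `|f x - f a|].
Proof.
move=> Sa fS e0; have e2 : 0 < e / 2 by rewrite divr_gt0.
have [s sP] := fS _ e2.
have sfin : finite_set [set x | c a x /\ comb s x <> comb s a].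
  elim: s {sP} => [|q s IH].
    by apply: sub_finite_set (finite_set0 W2) => x [_] /=; rewrite !comb_nil.
  apply: (@sub_finite_set _ _ ([set x | c a x /\ gen q.1 x <> gen q.1 a] `|`
     [set x | c a x /\ comb s x <> comb s a])).
    move=> x [cx]; rewrite !comb_cons => H /=.
    have [gE|gN] := pselect (gen q.1 x = gen q.1 a); last by left.
    by right; split=> // sE; apply: H; rewrite gE sE.
  by rewrite finite_setU; split=> //; exact: gen_ladder_cvg.
apply: sub_finite_set sfin => x [cx fx]; split=> // sE; move: fx; apply/negP; rewrite -leNgt.
have -> : f x - f a = (f x - comb s x) - (f a - comb s a) by rewrite sE; lra.
by apply: le_trans (ler_normB _ _) _; rewrite [leRHS]splitr lerD.
Qed.

Lemma gen_dist (x y : ladder_space) g g' : g <> g' ->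
  (forall t, fs_eval x t = gen g t) -> (forall t, fs_eval y t = gen g' t) -> 1 <= `|x - y|.
Proof.
have key (u v : ladder_space) h h' : (h < h')%O ->
    (forall t, fs_eval u t = gen h t) -> (forall t, fs_eval v t = gen h' t) -> 1 <= `|u - v|.
  move=> hh' uh vh; have := coord_le (fs_sup_coordinates ladder_function_space) (u - v) h'.
  rewrite (coordB (fs_sup_coordinates ladder_function_space)) uh vh gen_self gen_gt//.
  by rewrite sub0r normrN normr1.
move=> gg' xg yg; case: (ltgtP g g') => [lt|lt|//]; first exact: (key _ _ g g').
by rewrite distrC; exact: (key _ _ g' g).
Qed.

Lemma rational_comb s (e : R) : 0 < e -> exists s' : seq (W2 * rat),
  forall t, `|comb s t - comb [seq (q.1, ratr q.2) | q <- s'] t| <= e.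
Proof.
elim: s e => [|q s IH] e e0.
  by exists [::] => t; rewrite subrr normr0 ltW.
have e2 : 0 < e / 2 by rewrite divr_gt0.
have [s' sP'] := IH _ e2.
have [r rP] : exists r : rat, `|q.2 - ratr r| <= e / 2.
  have [|r] := @rat_in_itvoo R (q.2 - e / 2) (q.2 + e / 2); first by lra.
  by rewrite in_itv /= => /andP[r1 r2]; exists r; rewrite ler_distl; apply/andP; split; lra.
exists ((q.1, r) :: s') => t; rewrite /= !comb_cons /=.
set u := comb s t; set v := comb _ t.
have -> : q.2 * gen q.1 t + u - (ratr r * gen q.1 t + v) =
    (q.2 - ratr r) * gen q.1 t + (u - v) by lra.
apply: le_trans (ler_normD _ _) _; rewrite [leRHS]splitr; apply: lerD; last exact: sP'.
by rewrite normrM; apply: le_trans rP; rewrite ler_piMr// gen_le1.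
Qed.

End ladder_space.

(** * Density and weakly compact generation of the ladder space *)

Section ladder_space_properties.
Context {R : realType} {d1 : Order.disp_t} {W1 : orderType d1}.
Context {d2 : Order.disp_t} {W2 : orderType d2}.
Context (hW1 : is_omega1 W1) (hW2 : is_successor_cardinal W1 W2).
Context {S : set W2} {c : W2 -> set W2} (cS : ladder_system S c).

Local Notation X := (ladder_space (R := R) c).

Let W1abs : absorbing W1. Proof. exact: (succ_card_absorbing absorbing_nat hW1). Qed.

(** The blocks are the disjointified ladders together with their top, and the
    remaining points as singletons. *)
Lemma ladder_blocks b : disjointifiable S c b -> exists bl : W2 -> W2, [/\
  forall t, bl t = t \/ (S (bl t) /\ c (bl t) t),
  forall t, (t <= b)%O -> (bl t <= b)%O &
  forall g, (g <= b)%O -> finite_set (bl @` [set t | t = g \/ c g t])].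
Proof.
move=> [h [hlt hdisj]].
pose good t a := [/\ S a, (a <= b)%O, c a t & (h a < t)%O].
have /choice[bl blP] : forall t, exists a, good t a \/ (a = t /\ forall a', ~ good t a').
  move=> t; have [[a ga]|ng] := pselect (exists a, good t a); first by exists a; left.
  by exists t; right; split=> // a' ga; apply: ng; exists a'.
exists bl; split=> [t|t tb|g gb].
- by have [[Sb _ cb _]|[-> _]] := blP t; [right|left].
- by have [[_ + _ _]|[-> _]] := blP t.
have sub : [set t | t = g \/ c g t] `<=` [set t | t = g] `|`
    ((c g `&` [set t | (t <= h g)%O]) `|` [set t | c g t /\ (h g < t)%O]).
  move=> t [tg|cgt]; first by left.
  by right; have [th|ht] := leP t (h g); [left|right].
apply: (sub_finite_set (image_subset bl sub)).
rewrite !image_setU !finite_setU; split; first exact/finite_image/finite_set1.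
have [Sg|nSg] := pselect (S g); last first.
  have cg0 t : ~ c g t by move=> /(ladder_dom cS).
  by split; apply: (@sub_finite_set _ _ set0) => //; move=> _ [t [/cg0[]]].
split; first by apply/finite_image/(ladder_fin cS)/hlt.
apply: (@sub_finite_set _ _ [set g]); last exact: finite_set1.
move=> _ [t [cgt hgt] <-] /=; have [[Sb bb cb hb]|[_ /(_ g)]] := blP t.
  exact: (hdisj _ _ t).
by case; split.
Qed.

(** Within a block, an element of the span is constant up to [e] outside finitely
    many points, so it is approximated by one of countably many functions: those
    with rational values that are constant outside a finite part of the block. *)
Lemma ladder_block_separable (bl : W2 -> W2) :
  (forall t, bl t = t \/ (S (bl t) /\ c (bl t) t)) ->
  exists Q : nat -> W2 -> R, forall f i (e : R), in_span c f -> 0 < e ->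
    exists k, forall t, bl t = i -> `|f t - Q k t| <= e.
Proof.
move=> blP.
have /choice[h hP] : forall a, exists h : W2 -> nat, {in c a &, injective h}.
  by move=> a; have [h hinj _] := card_le_ex_inj (ladder_countable cS a) 0%N; exists h.
(* [num] enumerates each block, its top having number 0. *)
pose num t := if pselect (bl t = t) then 0%N else (h (bl t) t).+1.
have num_inj t t' : bl t = bl t' -> num t = num t' -> t = t'.
  rewrite /num => tt'; case: pselect => /= tE; case: pselect => //= t'E.
    by rewrite -tE -t'E.
  move=> [] hh; have [//|[_ ct]] := blP t; have [//|[_ ct']] := blP t'.
  rewrite -tt' in ct' hh; by apply: (hP (bl t)) => //; rewrite inE.
pose Q k t := if @unpickle (seq rat * rat)%type k is Some x then
   ratr (nth x.2 x.1 (num t)) else 0 : R.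
exists Q => f i e fS e0.
have e3 : 0 < e / 3 by rewrite divr_gt0.
have ratP (r : R) : exists q : rat, `|r - ratr q| <= e / 3.
  have [|q] := @rat_in_itvoo R (r - e / 3) (r + e / 3); first by lra.
  by rewrite in_itv /= => /andP[r1 r2]; exists q; rewrite ler_distl; apply/andP; split; lra.
have /choice[q qP] : forall n, exists q : rat, forall t, bl t = i -> num t = n ->
    `|f t - ratr q| <= e / 3.
  move=> n; have [[t [ti tn]]|nt] := pselect (exists t, bl t = i /\ num t = n).
    have [q qP] := ratP (f t); exists q => t' t'i t'n.
    by rewrite (num_inj t' t) ?t'i ?t'n.
  by exists 0 => t ti tn; case: nt; exists t.
have [q0 q0P] := ratP (f i).
have [N NP] : exists N : nat, forall t, bl t = i -> (N <= num t)%N -> `|f t - f i| <= e / 3.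
  have [Si|nSi] := pselect (S i); last first.
    exists 0%N => t ti _; have [tE|[]] := blP t; last by rewrite ti.
    by rewrite -ti tE subrr normr0 ltW.
  have /finite_seqP[s sP] := in_span_ladder_cvg cS Si fS e3.
  exists (\max_(t <- s) num t).+1 => t ti Nt.
  have [tE|[_ ct]] := blP t; first by rewrite -ti tE subrr normr0 ltW.
  rewrite leNgt; apply/negP => far; move: Nt; rewrite ltnNge => /negP; apply.
  have ts : t \in s by have : [set` s] t by rewrite -sP; split=> //; rewrite -ti.
  exact: leq_bigmax_seq.
exists (pickle (mkseq q N, q0)) => t ti; rewrite /Q pickleK /=.
have [tN|Nt] := ltnP (num t) N.
  by rewrite nth_mkseq//; apply: le_trans (qP _ _ ti erefl) _; lra.
rewrite nth_default ?size_mkseq//.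
have := NP t ti Nt => ?; have -> : f t - ratr q0 = (f t - f i) + (f i - ratr q0) by lra.
apply: le_trans (ler_normD _ _) _; lra.
Qed.

Lemma in_span_below_wcg (Z : completeNormedModType R) (ev : Z -> W2 -> R) b :
  sup_coordinates ev -> disjointifiable S c b ->
  (forall z, in_span_below c b (ev z)) -> weakly_compactly_generated Z.
Proof.
move=> Zev /ladder_blocks[bl [blP blb blfin]] Zb.
have [Q QP] := ladder_block_separable blP.
have [w _] := W1abs; pose w1 := w 0%N.
have [iota iota_inj _] := card_le_ex_inj (card_beloweq_le W1abs hW2 b) w1.
pose p t := iota (bl t).
apply: (c0_blocks_wcg Zev hW1 (p := p)
   (Q := fun i k t => if (t <= b)%O then Q k t else 0)).
- move=> z e e0; have [s sb sP] := Zb z e e0.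
  have /finite_seqP[J JP] : finite_set
      (\bigcup_(q in [set` s]) (p @` [set t | t = q.1 \/ c q.1 t])).
    apply: bigcup_finite => [|q qs]; first exact: finite_seq.
    have -> : p @` [set t | t = q.1 \/ c q.1 t] = iota @` (bl @` [set t | t = q.1 \/ c q.1 t]).
      by rewrite -image_comp.
    by apply/finite_image/blfin/ltW/sb.
  exists J => t tJ; have := sP t; rewrite (_ : comb c s t = 0) ?subr0//.
  rewrite /comb big_seq big1// => q qs; rewrite /gen asboolF ?mulr0// => qt.
  move: tJ; apply/negP/negPn.
  by have : [set` J] (p t) by rewrite -JP; exists q => //; exists t.
- move=> z i e e0.
  have zS : in_span c (ev z) by move=> e' /(Zb z)[s _ sP]; exists s.
  have [[t0 [t0b t0i]]|nt] := pselect (exists t, (t <= b)%O /\ p t = i); last first.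
    exists 0%N => t ti; case: ifPn => tb; first by case: nt; exists t.
    rewrite (in_span_below_eq0 cS (Zb z)) ?subrr ?normr0; first exact: ltW.
    by rewrite ltW// ltNge.
  have [k kP] := QP (ev z) (bl t0) e zS e0; exists k => t ti; case: ifPn => tb.
    by apply: kP; apply: iota_inj; rewrite ?inE/= ?blb//; rewrite -/(p t) ti.
  rewrite (in_span_below_eq0 cS (Zb z)) ?subrr ?normr0; first exact: ltW.
  by rewrite ltW// ltNge.
Qed.

(** A uniform limit of finite combinations involves only countably many
    generators, which are bounded. *)
Lemma in_span_below_ex f : in_span c f -> exists b, @in_span_below R _ _ c b f.
Proof.
move=> fS; have /choice[s sP] : forall n, exists s : seq (W2 * R),
    forall t, `|f t - comb c s t| <= n.+1%:R^-1.
  by move=> n; apply: fS; exact: inv_succ_gt0.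
have [|b bP] := @succ_card_bounded _ W1abs _ _ hW2 _ (\bigcup_n [set q | q \in s n]) fst.
  apply: (card_bigcup_le W1abs) => [|n _]; first exact/(countable_card_le W1abs)/countableP.
  exact/(countable_card_le W1abs)/finite_set_countable/finite_seq.
exists b => e e0; have [n ne] := inv_succ_le e0; exists (s n).
  by move=> q qs; apply: bP; exists n.
by move=> t; apply: le_trans ne.
Qed.

Lemma density_le_in_span_below (Y : closed_subspace X) :
  density_le (subspace_banach Y) W1 ->
  exists b, forall y : subspace_banach Y, in_span_below c b (fs_eval (val y : X)).
Proof.
move=> [D [[D' D'd D'D] _] DW1].
have D'W1 : D' #<= [set: W1].
  by apply: card_le_trans DW1; move: D'D; rewrite card_eq_le => /andP[].
have /choice[g gP] : forall y : subspace_banach Y,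
    exists b, in_span_below c b (fs_eval (val y : X)).
  by move=> y; apply: in_span_below_ex; exact: in_spanP.
have [b bP] := succ_card_bounded W1abs hW2 g D'W1.
exists b => y e e0; have e2 : 0 < e / 2 by rewrite divr_gt0.
have [y' D'y' yy'] := (dense_approx D').1 D'd y _ e2.
have [s sb sP] := in_span_belowW (ltW (bP _ D'y')) (gP y') e2; exists s => // t.
have Yev := subspace_sup_coordinates Y (fs_sup_coordinates (ladder_function_space (R := R) c)).
have := coord_le Yev (y - y') t; rewrite (coordB Yev) => le1.
have -> : fs_eval (val y : X) t - comb c s t =
  (fs_eval (val y : X) t - fs_eval (val y' : X) t) +
  (fs_eval (val y' : X) t - comb c s t) by lra.
apply: le_trans (ler_normD _ _) _; rewrite [leRHS]splitr; apply: lerD => //.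
exact: le_trans le1 (ltW yy').
Qed.

Lemma ladder_space_density : has_density X [set: W2].
Proof.
have W2abs := succ_card_absorbing W1abs hW2.
have lower (D : set X) : dense D -> [set: W2] #<= D.
  move=> /dense_approx Dd.
  have /choice[x xP] : forall g, exists x : X, forall t, fs_eval x t = gen c g t.
    by move=> g; apply: in_span_ex; exact: gen_in_span.
  apply/card_le_relP; exists (fun g y => `|x g - y| < 1 / 2); split.
    by move=> g _; have [|y Dy xy] := Dd (x g) (1 / 2); [lra|exists y].
  move=> g g' y _ _ xy x'y; apply: contrapT => gg'.
  have := gen_dist cS gg' (xP g) (xP g').
  have := ler_distD y (x g) (x g'); rewrite (distrC y); lra.
split=> //.
have /choice[x xP] : forall s : seq (W2 * rat), exists x : X,
    forall t, fs_eval x t = comb c [seq (q.1, ratr q.2) | q <- s] t.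
  by move=> s; apply: in_span_ex; exact: comb_in_span.
have Dd : dense (range x).
  apply/dense_approx => y e e0; have e3 : 0 < e / 3 by rewrite divr_gt0.
  have [s sP] := in_spanP y e3; have [s' sP'] := rational_comb c s e3.
  exists (x s'); first by exists s'.
  apply: (@le_lt_trans _ _ (e / 3 + e / 3)); last by lra.
  apply: fs_norm_le => [|t]; first by rewrite addr_ge0 ?ltW.
  have -> : fs_eval (y - x s') t =
      (fs_eval y t - comb c s t) + (comb c s t - fs_eval (x s') t).
    by rewrite addrA subrK.
  apply: le_trans (ler_normD _ _) _; apply: lerD => //.
  by rewrite xP; exact: sP'.
exists (range x) => //; rewrite card_eq_le lower// andbT.
apply: card_le_trans (card_image_le _ _) _.
apply: (@card_le_trans _ _ _
  [set s : seq (W2 * rat) | forall q, q \in s -> (setT `*` setT) q]).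
  exact: subset_card_le.
apply: (card_seq_le W2abs); apply: (card_setX_le W2abs) => //.
exact/(countable_card_le W2abs)/countableP.
Qed.

Lemma ladder_space_not_wcg : stationary S ->
  ~ weakly_compactly_generated X.
Proof.
move=> Sstat [C Cc Cspan].
have Xev := fs_sup_coordinates (ladder_function_space (R := R) c).
(* Rational values are coded by natural numbers. *)
pose rv (k : nat) : R := if @unpickle rat k is Some q then ratr q else 0.
pose wit (a : seq (W2 * nat) * nat) (x : X) := C x /\
  forall q, q \in a.1 -> `|fs_eval x q.1 - rv q.2| <= a.2.+1%:R^-1.
have /choice[b bP] : forall a, exists b, forall x, wit a x ->
    exists2 y, wit a y & in_span_below c b (fs_eval y).
  move=> a; have [[x ax]|nx] := pselect (exists x, wit a x).
    have [b xb] := in_span_below_ex (in_spanP x).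
    by exists b => _ _; exists x.
  have [b _] := in_span_below_ex (in_spanP (0 : X)).
  by exists b => x ax; case: nx; exists x.
(* The generators below [a] suffice to realise in [C] the data below [a]. *)
have [a [Sa Fa]] := Sstat _ (closed_under_closed (b := b))
  (closed_under_unbounded W1abs hW2 b).
have [x Cx xa] : exists2 x : X, C x & fs_eval x a != 0.
  apply: contrapT => nx.
  have C0 x : C x -> fs_eval x a = 0.
    by move=> Cx; apply/eqP/negPn/negP => xa; apply: nx; exists x.
  have [ga gaP] := in_span_ex (gen_in_span (R := R) c a).
  have : closure (linear_span C) ga by rewrite Cspan.
  move=> /(_ (ball ga (1 / 2)))[|y [[n [r [z [Cz ->]]]]]].
    by apply: nbhsx_ballx; lra.
  rewrite -ball_normE /ball_ /= => H.
  have := coord_le Xev (ga - \sum_(i < n) r i *: z i) a.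
  rewrite (coordB Xev) (coord_sum Xev) big1 => [|i _].
    by rewrite gaP (gen_self c) subr0 normr1; lra.
  by rewrite (coordZ Xev) C0// mulr0.
(* An increasing sequence in the ladder of [a]. *)
have [a0 a0a] := ladder_pos cS Sa.
have /choice[nxt nxtP] : forall y, exists z, (y < a)%O -> c a z /\ (y < z)%O.
  move=> y; have [ya|] := boolP (y < a)%O; last by exists y.
  by have [z cz yz] := ladder_cof cS Sa ya; exists z.
pose g n := iter n nxt (nxt a0).
have ga n : c a (g n).
  elim: n => [|n IH]; first exact: (nxtP _ a0a).1.
  exact: (nxtP _ (ladder_lt cS IH)).1.
have g_lt m n : (m < n)%N -> (g m < g n)%O.
  elim: n => // n IH; have gS : (g n < g n.+1)%O by exact: (nxtP _ (ladder_lt cS (ga n))).2.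
  rewrite ltnS leq_eqVlt => /predU1P[->//|/IH mn]; exact: lt_trans mn gS.
have g_inj : injective g.
  move=> m n gmn; case: (ltngtP m n) => // /g_lt; by rewrite gmn ltxx.
have ratP n (r : R) : exists k, `|r - rv k| <= n.+1%:R^-1.
  have e0 : 0 < n.+1%:R^-1 :> R by exact: inv_succ_gt0.
  set e := n.+1%:R^-1 in e0 *.
  have [|q] := @rat_in_itvoo R (r - e) (r + e); first by lra.
  rewrite in_itv /= => /andP[r1 r2]; exists (pickle q); rewrite /rv pickleK.
  by rewrite ler_distl; apply/andP; split; lra.
have /choice[xs xsP] : forall n, exists y : X, [/\ C y, fs_eval y a = 0 &
    forall i, (i < n)%N -> `|fs_eval x (g i) - fs_eval y (g i)| <= n.+1%:R^-1 + n.+1%:R^-1].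
  move=> n; have /choice[k kP] := fun i => ratP n (fs_eval x (g i)).
  pose s := [seq (g i, k i) | i <- iota 0 n].
  have [|y [Cy yP] yb] := bP (s, n) x.
    by split=> // _ /mapP[i _ ->]; exact: kP.
  exists y; split=> // [|i ni].
    apply: (in_span_below_eq0 cS yb); apply: Fa => q /mapP[i _ ->] /=.
    exact: (ladder_lt cS (ga i)).
  have /yP yi : (g i, k i) \in s by apply: map_f; rewrite mem_iota.
  have -> : fs_eval x (g i) - fs_eval y (g i) =
    (fs_eval x (g i) - rv (k i)) - (fs_eval y (g i) - rv (k i)) by lra.
  by apply: le_trans (ler_normB _ _) _; apply: lerD.
have xsC n : C (xs n) by have [] := xsP n.
have [y Cy ycl] := weakly_compact_seq Cc xsC.
have ya : fs_eval y a = 0.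
  have [f fP] := coord_dual Xev a; rewrite -fP; apply: ycl.
  rewrite (_ : _ \o _ = cst 0); first exact: cvg_cst.
  by apply/funext => n /=; rewrite fP; have [] := xsP n.
have yg i : fs_eval y (g i) = fs_eval x (g i).
  have [f fP] := coord_dual Xev (g i); rewrite -fP; apply: ycl.
  apply/cvgrPdist_lt => e e0; have e2 : 0 < e / 3 by rewrite divr_gt0.
  have [N NP] := inv_succ_le e2.
  exists (maxn N i.+1) => // n /=; rewrite geq_max => /andP[Nn ni].
  rewrite fP; have [_ _ /(_ _ ni) xn] := xsP n.
  have nN : n.+1%:R^-1 <= N.+1%:R^-1 :> R by rewrite lef_pV2 ?posrE ?ltr0n// ler_nat.
  have ne := le_trans nN NP.
  have ee : n.+1%:R^-1 + n.+1%:R^-1 < e by apply: le_lt_trans (lerD ne ne) _; lra.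
  exact: le_lt_trans xn ee.
(* Far up the ladder, [x] is close to [x a] and [y] to [y a], which is 0. *)
have e0 : 0 < `|fs_eval x a| / 3 by rewrite divr_gt0// normr_gt0.
have xfin := in_span_ladder_cvg cS Sa (in_spanP x) e0.
have yfin := in_span_ladder_cvg cS Sa (in_spanP y) e0.
have [i [nx ny]] : exists i,
    ~ (c a (g i) /\ `|fs_eval x a| / 3 < `|fs_eval x (g i) - fs_eval x a|) /\
    ~ (c a (g i) /\ `|fs_eval x a| / 3 < `|fs_eval y (g i) - fs_eval y a|).
  apply: contrapT => nex; apply: infinite_nat.
  pose E := [set t | c a t /\ `|fs_eval x a| / 3 < `|fs_eval x t - fs_eval x a|] `|`
    [set t | c a t /\ `|fs_eval x a| / 3 < `|fs_eval y t - fs_eval y a|].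
  apply: (@card_le_finite _ _ _ E); last by rewrite finite_setU.
  apply: (card_le_inj (f := g)) => [m n _ _ /g_inj//|i _].
  by apply: contrapT => /not_orP H; apply: nex; exists i.
move: nx ny => /not_andP[//|/negP]; rewrite -leNgt => nx /not_andP[//|/negP].
rewrite -leNgt yg ya subr0 => ny.
have := ler_distD (fs_eval x (g i)) (fs_eval x a) 0.
rewrite !subr0 (distrC (fs_eval x a)).
have : 0 < `|fs_eval x a| by rewrite normr_gt0.
lra.
Qed.

End ladder_space_properties.

Theorem theorem4p3 (R : realType)
    (d1 : Order.disp_t) (W1 : orderType d1)
    (d2 : Order.disp_t) (W2 : orderType d2)
    (hW1 : is_omega1 W1) (hW2 : is_successor_cardinal W1 W2)
    (S : set W2) (S_stat : stationary S)
    (S_cof : forall a : W2, S a -> has_cofinality (below a) nat)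
    (S_nonrefl : forall b : W2,
       has_cofinality (below b) W1 -> ~ stationary (trace S b)) :
  exists X : completeNormedModType R,
    [/\ has_density X [set: W2],
        ~ weakly_compactly_generated X &
        forall Y : closed_subspace X, density_le (subspace_banach Y) W1 ->
          weakly_compactly_generated (subspace_banach Y)].
Proof.
have wo : well_ordered W2 by case: hW2.
have [c cS] := ladder_system_exists wo S_cof.
exists (ladder_space c); split.
- exact: (ladder_space_density hW1 hW2 cS).
- exact: (ladder_space_not_wcg hW1 hW2 cS S_stat).
move=> Y /(density_le_in_span_below hW1 hW2)[b Yb].
apply: (in_span_below_wcg hW1 hW2 cS _ _ Yb).
  exact/subspace_sup_coordinates/fs_sup_coordinates.
exact: (nonreflecting_disjointifiable hW1 hW2 S_cof S_nonrefl cS).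
Qed.
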